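(* Let $M\ge 1$ be an integer, let $\mu\in\mathcal M_0$ be different from the point mass at $0$, and let $\eta$ be a probability measure on $\Omega$ such that: (i) the sequence $\{\omega_x\}_{x\in\mathbb Z}$ is stationary and ergodic under $\eta$, and $\eta(\omega\in\Omega^+_{M,\mu})=1$; (ii) $\mu([-B,B])=1$ for some $B<\infty$, and the span of $\operatorname{supp}\mu$ is $1$; (iii) $E_\eta\big[\sum_{j=1}^M\sum_{z\in\mathbb Z}|z|\,\omega_{0,j}(z)\big]<\infty$. Let $\delta=E_\eta\big[\sum_{j\ge1}d(\omega_{0,j})\big]$. Then: (1) $\mathbb P_\eta(\mathcal R\cup\mathcal T_+)=1$. (2) Moreover, if $\delta<1$ then $\mathbb P_\eta(\mathcal R)=1$.
   Context: $\mathbb N=\{1,2,\dots\}$, $\mathbb Z_+=\{0,1,2,\dots\}$. $M_1(\mathbb Z)$ is the space of probability distributions on $\mathbb Z$, and $d(\nu)=\sum_z z\,\nu(z)$ is the mean of $\nu\in M_1(\mathbb Z)$ (when finite). $\mathcal M_0=\{\nu\in M_1(\mathbb Z): d(\nu)=0\}$ and $\mathcal M_+=\{\nu\in M_1(\mathbb Z): d(\nu)\in[0,\infty)\}$. $\Omega=M_1(\mathbb Z)^{\mathbb Z\times\mathbb N}$ is the space of cookie environments $\omega=\{\omega_{x,j}\}_{x\in\mathbb Z,j\ge1}$, and $\omega_x=\{\omega_{x,j}\}_{j\ge1}$. $\Omega_{M,\mu}^+=(\mathcal M_+^M\times\{\mu\}^{\mathbb N})^{\mathbb Z}$, i.e.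 $\omega\in\Omega_{M,\mu}^+$ iff $d(\omega_{x,j})\in[0,\infty)$ for all $x$ and $j\le M$, and $\omega_{x,j}=\mu$ for all $x$ and $j>M$. The span of $\operatorname{supp}\mu$ is $1$ means that $\operatorname{supp}\mu$ is not contained in $k\mathbb Z$ for any integer $k\ge2$ (so simple symmetric random walk is allowed). Given $\omega\in\Omega$ and $x\in\mathbb Z$, the excited random walk $\{X_n\}_{n\ge0}$ has law $P_\omega^x$ with $P_\omega^x(X_0=x)=1$ and $P_\omega^x(X_{n+1}=X_n+z\mid\sigma(X_k,k\le n))=\omega_{X_n,L_n(X_n)}(z)$, where $L_n(y)=\sum_{k=0}^n\mathbf 1_{\{X_k=y\}}$. Given a probability measure $\eta$ on $\Omega$, $\mathbb P_\eta(\cdot)=E_\eta[P_\omega^0(\cdot)]$ is the averaged law started at $0$. $\mathcal R=\{\sum_{n\ge0}\mathbf 1_{\{X_n=x\}}=\infty\ \forall x\in\mathbb Z\}$ and $\mathcal T_+=\{\lim_{n\to\infty}X_n=+\infty\}$. *)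

(* Defs.v *)
From HB Require Import structures.
From mathcomp Require Import all_boot all_order all_algebra.
From mathcomp Require Import all_classical all_reals all_analysis.
From mathcomp Require Import measurable_realfun.

Set Implicit Arguments.
Unset Strict Implicit.
Unset Printing Implicit Defensive.

Import Order.TTheory GRing.Theory Num.Theory.
Import numFieldNormedType.Exports.

Local Open Scope classical_set_scope.
Local Open Scope ring_scope.
Local Open Scope ereal_scope.

HB.instance Definition _ := isPointed.Build int 0%R.

HB.instance Definition _ := @isMeasurable.Build default_measure_display
  int discrete_measurable discrete_measurable0
  discrete_measurableC discrete_measurableU.

Section product_sigma_algebra.
Context (I : Type) d (T : measurableType d).

Definition coordinate_preimages : set (set (I -> T)) :=
  \bigcup_(i in [set: I])
    preimage_set_system setT (fun f : I -> T => f i) measurable.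

Definition prod_measurableType : measurableType coordinate_preimages.-sigma :=
  g_sigma_algebraType coordinate_preimages.

End product_sigma_algebra.

Section conditional_probability.
Context d (T : measurableType d) (R : realType).

(* f is a version of the conditional probability P(E | G), for a
   sub-sigma-algebra G. *)
Definition is_cond_probability (P : probability T R) (G : set (set T))
    (E : set T) (f : T -> \bar R) : Prop :=
  (forall B : set (\bar R), measurable B -> G (f @^-1` B)) /\
  (forall A, G A -> P (A `&` E) = \int[P]_(w in A) f w).

End conditional_probability.

Section step_distributions.
Context (R : realType).

(* M_1(Z), with the sigma-algebra generated by the evaluations nu |-> nu(A). *)
Definition M1 : measurableType _ := pprobability int R.

(* The mean of nu; only meaningful under has_mean, since a divergent integral
   still gets a value in \bar R. *)
Definition mean (nu : probability int R) : \bar R :=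
  'E_nu[fun z : int => z%:~R].

Definition has_mean (nu : probability int R) : Prop :=
  nu.-integrable [set: int] (fun z : int => (z%:~R : R)%:E).

Definition M_zero : set M1 := [set nu | has_mean nu /\ mean nu = 0].

Definition M_plus : set M1 := [set nu | has_mean nu /\ 0 <= mean nu].

Definition support (nu : probability int R) : set int :=
  [set z | nu [set z] != 0].

Definition span_one (nu : probability int R) : Prop :=
  forall k : int, (2 <= k)%R -> ~ support nu `<=` [set z | (k %| z)%Z].

End step_distributions.

Section cookie_environments.
Context (R : realType).

(* Cookies are numbered from 0: omega x j is the (j+1)-st cookie at site x. *)
Definition cookie_stack : measurableType _ := prod_measurableType nat (M1 R).

Definition environment : measurableType _ :=
  prod_measurableType int cookie_stack.

Definition Omega_plus (M : nat) (mu : M1 R) : set environment :=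
  [set omega | forall x : int,
     (forall j, (j < M)%N -> M_plus (omega x j)) /\
     (forall j, (M <= j)%N -> omega x j = mu)].

Definition shift (omega : environment) : environment :=
  fun x => omega (x + 1)%R.

Definition stationary (eta : probability environment R) : Prop :=
  forall A, measurable A -> eta (shift @^-1` A) = eta A.

Definition ergodic (eta : probability environment R) : Prop :=
  forall A, measurable A -> shift @^-1` A = A -> eta A = 0 \/ eta A = 1.

End cookie_environments.

Section excited_random_walk.
Context (R : realType).

Definition path_space : measurableType _ := prod_measurableType nat int.

(* L_n(y), the number of visits to y up to and including time n. *)
Definition local_time (X : path_space) (n : nat) (y : int) : nat :=
  (\sum_(k < n.+1) (X k == y))%N.

(* sigma(X_k, k <= n) *)
Definition past (n : nat) : set (set path_space) :=
  g_sigma_preimage (fun (k : 'I_n.+1) (X : path_space) => X k).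

(* P is the law P_omega^x; since local_time X n (X n) >= 1, the cookie consumed
   at time n has 0-based number (local_time X n (X n)).-1. *)
Definition excited_walk_law (omega : environment R) (x : int)
    (P : probability path_space R) : Prop :=
  P [set X | X 0%N = x] = 1 /\
  forall (n : nat) (z : int),
    is_cond_probability P (past n) [set X | X n.+1 = (X n + z)%R]
      (fun X => (omega (X n) (local_time X n (X n)).-1 : probability int R)
                  [set z]).

Definition averaged_law (eta : probability (environment R) R)
    (P : environment R -> probability path_space R) (A : set path_space)
    : \bar R :=
  \int[eta]_omega P omega A.

Definition recurrent : set path_space :=
  [set X | forall x : int,
     \sum_(0 <= n <oo) ((X n == x)%:R : R)%:E = +oo].

Definition transient_right : set path_space :=
  [set X | ((X n)%:~R : R) @[n --> \oo] --> +oo%R].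

End excited_random_walk.

(* E_eta [ sum_{j <= M} sum_z |z| omega_{0,j}(z) ] *)
Definition abs_drift (R : realType) (M : nat)
    (eta : probability (environment R) R) : \bar R :=
  \int[eta]_omega
    \sum_(j < M) 'E_(omega 0%R j : probability int R)[fun z => `|z|%:~R].

(* delta = E_eta [ sum_{j >= 1} d(omega_{0,j}) ] *)
Definition total_drift (R : realType)
    (eta : probability (environment R) R) : \bar R :=
  \int[eta]_omega \sum_(0 <= j <oo) mean (omega 0%R j).

(* Main.v *)
Require Import Defs.
From mathcomp Require Import all_boot all_order all_algebra.
From mathcomp Require Import all_classical all_reals all_analysis.
From mathcomp Require Import measurable_realfun.
From mathcomp Require Import zify ring lra.

(** Everything is quenched: fix a typical environment [omega] and let [Pr] be the
law of the walk in [omega].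

Stop the walk, after an arbitrary history, when it leaves the window [-lN, rN].
Optional stopping applied to X minus the consumed drift bounds the probability of
leaving on a given side, since the total drift available in the window and the
expected overshoot are controlled by window sums of stationary functions, hence by
[gamma (l + r) N] for infinitely many N. As the bound holds after every history, an
escape probability bounded below improves to 1. With l = r this shows
limsup X = +oo; if delta < 1, a window with r much larger than l shows that X is
negative infinitely often.

A site visited infinitely often makes, by conditional Borel-Cantelli and since the
support of mu generates Z as a semigroup, every site visited infinitely often.
Otherwise |X| tends to infinity; by (iii) only finitely many jumps are longer than the
current distance to 0, so that X does not change sign infinitely often.

The only ergodic input is that liminf of the window averages of g >= 0 is at most E g,
which follows from Markov's inequality for a shift-monotone event. *)

Set Implicit Arguments.
Unset Strict Implicit.
Unset Printing Implicit Defensive.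

Import Order.TTheory GRing.Theory Num.Theory.
Import numFieldNormedType.Exports.

Local Open Scope classical_set_scope.
Local Open Scope ring_scope.
Local Open Scope ereal_scope.

(** * Measurability in product spaces *)

Section product_measurability.
Context (I : Type) d (T : measurableType d).

Lemma measurable_proj (i : I) :
  measurable_fun setT (fun f : prod_measurableType I T => f i).
Proof. by move=> _ B mB; apply: sub_sigma_algebra; exists i => //; exists B. Qed.

Lemma measurable_to_prod d' (S : measurableType d') (f : S -> prod_measurableType I T) :
  (forall i, measurable_fun setT (fun s => f s i)) -> measurable_fun setT f.
Proof.
move=> mf; apply: (@measurability _ _ S (prod_measurableType I T) setT f
  (coordinate_preimages (I := I) (T := T))) => //.
move=> _ [_ [i _ [B mB <-]] <-]; rewrite setTI.
by have := mf i measurableT B mB; rewrite !setTI.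
Qed.

End product_measurability.

(** * Decomposition along a countable-valued map *)

Section countable_fibers.
Context d (T : measurableType d) (R : realType) (I : countType).
Variables (m : {measure set T -> \bar R}) (f : T -> I).
Hypothesis mf : forall i, measurable (f @^-1` [set i]).

(** The fibres are numbered through [pickle] so that sigma-additivity over [nat] applies; a number
    that codes no element of [I] gives the empty set. *)
Let fib n := f @^-1` [set i | pickle i = n].

Let fibP n : (exists i, fib n = f @^-1` [set i]) \/ fib n = set0.
Proof.
rewrite /fib; have [[i <-]|ni] := pselect (exists i : I, pickle i = n).
  left; exists i; rewrite (_ : [set j | _] = [set i])//.
  by apply/seteqP; split=> [j /=|j ->//]; exact: (pcan_inj pickleK).
right; rewrite (_ : [set j | _] = set0) ?preimage_set0//.
by apply/seteqP; split=> // j /= jn; apply: ni; exists j.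
Qed.

Let mfib n : measurable (fib n).
Proof. by have [[i ->]|->] := fibP n. Qed.

Let trivfib A : trivIset setT (fun n => A `&` fib n).
Proof.
by apply/trivIsetP => i j _ _ ij; apply/seteqP; split => // x [[_ +] [_]] /=;
  rewrite /fib/= => -> /eqP; rewrite (negbTE ij).
Qed.

Let bigfib A : \bigcup_n (A `&` fib n) = A.
Proof.
apply/seteqP; split=> [x [n _ []]//|x Ax].
by exists (pickle (f x)) => //.
Qed.

Let ge0_integral_fibers A (g : T -> \bar R) :
  measurable A -> measurable_fun A g -> (forall x, A x -> 0 <= g x) ->
  \int[m]_(x in A) g x = \sum_(n <oo) \int[m]_(x in A `&` fib n) g x.
Proof.
move=> mA mg g0; rewrite -[in LHS](bigfib A).
rewrite ge0_integral_bigcup ?bigfib// => n; exact: measurableI.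
Qed.

(** Conditioning in elementary form: on a fibre the countable-valued statistic [f] is constant, and
    integrals that agree on all fibres add up to the same total. *)
Lemma ge0_eq_integral_fibers A (g h : T -> \bar R) :
  measurable A -> measurable_fun A g -> measurable_fun A h ->
  (forall x, A x -> 0 <= g x) -> (forall x, A x -> 0 <= h x) ->
  (forall i, \int[m]_(x in A `&` f @^-1` [set i]) g x =
             \int[m]_(x in A `&` f @^-1` [set i]) h x) ->
  \int[m]_(x in A) g x = \int[m]_(x in A) h x.
Proof.
move=> mA mg mh g0 h0 gh; rewrite !ge0_integral_fibers//.
apply: eq_eseriesr => n _; have [[i ->]//|->] := fibP n.
by rewrite setI0 !integral_set0.
Qed.

Let measure_fibers A : measurable A -> m A = \sum_(n <oo) m (A `&` fib n).
Proof.
move=> mA; rewrite -[in LHS](bigfib A) measure_bigcup//.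
  by apply: eq_eseriesl => i; rewrite in_setT.
by move=> i _; exact: measurableI.
Qed.

Lemma le_measure_fibers A B (c : R) : measurable A -> measurable B ->
  (0 <= c)%R ->
  (forall i, m (A `&` f @^-1` [set i]) <= c%:E * m (B `&` f @^-1` [set i])) ->
  m A <= c%:E * m B.
Proof.
move=> mA mB c0 AB; rewrite [in leLHS]measure_fibers// [in leRHS]measure_fibers//.
rewrite -nneseriesZl//; apply: lee_nneseries => // n _.
have [[i ->]//|->] := fibP n.
by rewrite !setI0 !measure0 mule0.
Qed.

Lemma measurable_fun_fibers d' (T' : measurableType d') A (phi : I -> T') :
  measurable_fun A (fun x => phi (f x)).
Proof.
move=> mA B mB; apply: measurableI => //.
rewrite (_ : _ @^-1` _ =
    \bigcup_n ((fun x => phi (f x)) @^-1` B `&` fib n)); last by rewrite bigfib.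
apply: bigcup_measurable => n _; have [[i ->]|->] := fibP n; last by rewrite setI0.
have [Bi|nBi] := pselect (B (phi i)).
  rewrite (_ : _ `&` _ = f @^-1` [set i])//.
  by apply/seteqP; split=> [x []//|x /= xi]; rewrite xi.
rewrite (_ : _ `&` _ = set0)//.
by apply/seteqP; split=> // x [] /= + xi; rewrite xi.
Qed.

Lemma ge0_integral_fibersE A (phi : I -> \bar R) : measurable A ->
  (forall i, 0 <= phi i) ->
  \int[m]_(x in A) phi (f x) = \sum_(n <oo)
    if @pickle_inv I n is Some i then phi i * m (A `&` f @^-1` [set i]) else 0.
Proof.
move=> mA phi0.
rewrite ge0_integral_fibers//; last exact: measurable_fun_fibers.
apply: eq_eseriesr => n _; rewrite /fib.
case E : (@pickle_inv I n) => [i|]; last first.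
  rewrite (_ : [set j | _] = set0) ?preimage_set0 ?setI0 ?integral_set0//.
  by apply/seteqP; split=> // j /= jn; move: E; rewrite -jn pickleK_inv.
have ni : pickle i = n by have := @pickle_invK I n; rewrite /oapp E.
rewrite (_ : [set j | _] = [set i]); last first.
  by apply/seteqP; split=> [j /=|j ->//]; rewrite -ni; exact: (pcan_inj pickleK).
transitivity (\int[m]_(x in A `&` f @^-1` [set i]) cst (phi i) x).
  by apply: eq_integral => x; rewrite inE => -[_ /= ->].
by rewrite integral_cst//; exact: measurableI.
Qed.

End countable_fibers.

(** Both sides are series over the values [i] in which only the masses of the fibres enter. This
    turns step probabilities into integrals against a cookie, and shows that point masses determine
    a law on the integers. *)
Lemma ge0_integral_transfer d1 d2 (T1 : measurableType d1)
    (T2 : measurableType d2) (R : realType) (I : countType)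
    (m1 : {measure set T1 -> \bar R}) (m2 : {measure set T2 -> \bar R})
    (f1 : T1 -> I) (f2 : T2 -> I) A1 A2 (c : R) (phi : I -> \bar R) :
  (forall i, measurable (f1 @^-1` [set i])) ->
  (forall i, measurable (f2 @^-1` [set i])) ->
  measurable A1 -> measurable A2 -> (0 <= c)%R -> (forall i, 0 <= phi i) ->
  (forall i, m1 (A1 `&` f1 @^-1` [set i]) = c%:E * m2 (A2 `&` f2 @^-1` [set i])) ->
  \int[m1]_(x in A1) phi (f1 x) = c%:E * \int[m2]_(x in A2) phi (f2 x).
Proof.
move=> mf1 mf2 mA1 mA2 c0 phi0 m12.
rewrite !ge0_integral_fibersE// -nneseriesZl//; last first.
  by move=> n _; case: pickle_inv => // i; rewrite mule_ge0.
apply: eq_eseriesr => n _; case: pickle_inv => [i|]; last by rewrite mule0.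
by rewrite m12 muleCA.
Qed.

(** * Events of the path *)

Section path_events.

Lemma past_coord (n k : nat) (z : int) : (k <= n)%N ->
  past n [set X : path_space | X k = z].
Proof.
move=> kn; apply: sub_sigma_algebra.
rewrite -bigcup_mkord_ord; exists k => //.
by exists [set z] => //; rewrite setTI; apply/seteqP; split=> X /=; rewrite inordK.
Qed.

Lemma past_determined n (A : set path_space) :
  (forall X Y : path_space, (forall k, (k <= n)%N -> X k = Y k) -> A X -> A Y) ->
  past n A.
Proof.
move=> detA.
pose C (s : seq int) := [set X : path_space | forall k, (k <= n)%N -> X k = nth 0%R s k].
have pC s : past n (C s).
  rewrite (_ : C s = \bigcap_(k in [set k | (k <= n)%N]) [set X : path_space | X k = nth 0%R s k]).
    apply: (@bigcap_measurable _ (g_sigma_algebraType _)); first by exists 0%N.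
    by move=> k kn; exact: past_coord.
  by apply/seteqP; split=> X h k; exact: h.
pose F i := if unpickle i is Some s then
  (if `[< exists2 X, A X & C s X >] then C s else set0) else set0.
rewrite (_ : A = \bigcup_i F i).
  apply: (@bigcup_measurable _ (g_sigma_algebraType _)) => i _.
  rewrite /F; case: unpickle => [s|]; last exact: (@measurable0 _ (g_sigma_algebraType _)).
  by case: ifP => _; [exact: pC|exact: (@measurable0 _ (g_sigma_algebraType _))].
apply/seteqP; split=> [X AX|Y [i _]].
  exists (pickle (mkseq X n.+1)) => //; rewrite /F pickleK.
  have CX : C (mkseq X n.+1) X by move=> k kn; rewrite nth_mkseq.
  by rewrite ifT//; apply/asboolP; exists X.
rewrite /F; case: unpickle => // s; case: ifP => // /asboolP[X AX CX] CY.
by apply: detA AX => k kn; rewrite CX// CY.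
Qed.

Lemma past_measurable n A : past n A -> measurable (A : set path_space).
Proof.
move: A; apply: smallest_sub; first exact: sigma_algebra_measurable.
move=> A; rewrite -bigcup_mkord_ord => -[k _ [B mB <-]].
exact: (@measurable_proj nat _ int).
Qed.

Lemma pastI n A B : past n A -> past n B -> past n (A `&` B).
Proof. exact: (@measurableI _ (g_sigma_algebraType _)). Qed.

End path_events.

(** * Cookies and the one-step law *)

(** Counting only times before [n] makes [visits X n (X n)] the number, starting from 0, of the
    cookie used at time [n]. *)
Definition visits (X : path_space) (n : nat) (y : int) : nat :=
  (\sum_(k < n) (X k == y))%N.

Lemma visitsS X n y : visits X n.+1 y = (visits X n y + (X n == y))%N.
Proof. by rewrite /visits big_ord_recr. Qed.

Lemma local_time_visits X n : (local_time X n (X n)).-1 = visits X n (X n).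
Proof. by rewrite -[local_time _ _ _]/(visits X n.+1 (X n)) visitsS eqxx addn1. Qed.

Lemma eq_visits X Y n y : (forall k, (k < n)%N -> X k = Y k) ->
  visits X n y = visits Y n y.
Proof. by move=> XY; apply: eq_bigr => i _; rewrite XY. Qed.

Lemma leq_visits X y : {homo (visits X)^~ y : m n / (m <= n)%N}.
Proof.
apply: homo_leq => // [n|n]; first exact: leq_trans.
by rewrite visitsS leq_addr.
Qed.

(* Every visit to x uses a new cookie of the stack at x. *)
Lemma sum_used_cookies (R : realType) (M : nat) (F : int -> nat -> \bar R)
    (s : seq int) (X : path_space) (n : nat) :
  uniq s -> (forall x j, 0 <= F x j) ->
  (forall x j, (M <= j)%N -> F x j = 0) ->
  (forall k, (k < n)%N -> X k \notin s -> F (X k) (visits X k (X k)) = 0) ->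
  \sum_(k < n) F (X k) (visits X k (X k)) <= \sum_(x <- s) \sum_(j < M) F x j.
Proof.
move=> us F0 FM Fs.
(* Regroup by site: the cookies used at [x] are the first [visits X n x] of its stack. *)
have -> : \sum_(k < n) F (X k) (visits X k (X k)) =
    \sum_(x <- s) \sum_(j < visits X n x) F x j.
  elim: n Fs => [|n IH] Fs.
    by rewrite big_ord0 big1// => x _; rewrite /visits !big_ord0.
  rewrite big_ord_recr /= IH; last by move=> k kn; apply: Fs; exact: ltnW.
  have [Xs|Xs] := boolP (X n \in s).
    rewrite [in LHS](bigD1_seq (X n))//= [in RHS](bigD1_seq (X n))//=.
    rewrite visitsS eqxx addn1 big_ord_recr/= -!addeA; congr (_ + _).
    rewrite addeC; congr (_ + _); apply: eq_bigr => x xX.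
    by rewrite visitsS eq_sym (negbTE xX) addn0.
  rewrite Fs// adde0; apply: eq_big_seq => x xs.
  rewrite visitsS (_ : (X n == x) = false) ?addn0//.
  by apply: contraNF Xs => /eqP ->.
apply: lee_sum => x _.
rewrite -!(big_mkord xpredT (F x)).
have [vM|/ltnW Mv] := leqP (visits X n x) M.
  rewrite [leRHS](big_cat_nat (n := visits X n x))//=.
  by rewrite leeDl// sume_ge0.
rewrite [leLHS](big_cat_nat (n := M))//= [X in _ + X]big_nat_cond.
by rewrite [X in _ + X]big1 ?adde0// => j /andP[/andP[Mj _] _]; exact: FM.
Qed.

Definition cookie_steps (R : realType) (omega : environment R)
    (Pr : probability path_space R) : Prop :=
  forall (n : nat) (z : int),
    is_cond_probability Pr (past n) [set X | X n.+1 = (X n + z)%R]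
      (fun X => (omega (X n) (local_time X n (X n)).-1 : probability int R)
                  [set z]).

Section step_law.
Context (R : realType) (omega : environment R) (Pr : probability path_space R).
Hypothesis step : cookie_steps omega Pr.

Lemma prob_step k A z : past k A ->
  Pr (A `&` [set X | X k.+1 = (X k + z)%R]) =
  \int[Pr]_(X in A) (omega (X k) (visits X k (X k)) : probability int R) [set z].
Proof.
move=> pA; rewrite (proj2 (step k z) _ pA).
by apply: eq_integral => X _; rewrite local_time_visits.
Qed.

(** There are countably many pairs of a position and a cookie number at time [k]; on the event that
    fixes the pair, the step follows a single cookie, so the point probabilities of [prob_step]
    suffice. *)
Lemma one_step k A (phi : int -> int -> \bar R) :
  past k A -> (forall x z, 0 <= phi x z) ->
  \int[Pr]_(X in A) phi (X k) (X k.+1 - X k)%R =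
  \int[Pr]_(X in A)
    \int[omega (X k) (visits X k (X k)) : probability int R]_z phi (X k) z.
Proof.
move=> pA phi0.
pose f (X : path_space) := (X k, visits X k (X k)).
have pf i : past k (f @^-1` [set i]).
  apply: past_determined => X Y XY; rewrite /f /= => <-.
  by rewrite XY// (@eq_visits X Y)// => j /ltnW; exact: XY.
have mf i : measurable (f @^-1` [set i]) by exact: (past_measurable (pf i)).
have mk (g : int -> int -> int) i :
    measurable ((fun X : path_space => g (X k) (X k.+1)) @^-1` [set i]).
  apply: (@past_measurable k.+1); apply: past_determined => X Y XY.
  by rewrite /= !XY.
apply: (ge0_eq_integral_fibers mf).
- exact: past_measurable pA.
- apply: (@measurable_fun_fibers _ path_space (int * int)%type
    (fun X => (X k, X k.+1)) _ _ _ _ (fun p => phi p.1 (p.2 - p.1)%R)) => -[x y].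
  apply: (@past_measurable k.+1); apply: past_determined => X Y XY.
  by rewrite /= !XY.
- exact: (@measurable_fun_fibers _ path_space _ f mf _ _ _
    (fun p => \int[omega p.1 p.2 : probability int R]_z phi p.1 z)).
- by move=> *.
- by move=> *; exact: integral_ge0.
move=> [x j].
set B := A `&` _.
have pB : past k B by exact: pastI.
have mB := past_measurable pB.
rewrite [RHS](_ : _ = \int[Pr]_(X in B)
    cst (\int[omega x j : probability int R]_z phi x z) X); last first.
  by apply: eq_integral => X; rewrite inE => -[_ [/= -> ->]].
rewrite integral_cst//.
have PB : Pr B = (fine (Pr B))%:E by rewrite fineK// fin_num_measure.
rewrite -[RHS]/(_ * Pr B) [RHS]muleC [in RHS]PB.
transitivity (\int[Pr]_(X in B) phi x (X k.+1 - x)%R).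
  by apply: eq_integral => X; rewrite inE => -[_ [/= -> _]].
apply: (@ge0_integral_transfer _ _ path_space int R int Pr (omega x j : probability int R)
  (fun X => X k.+1 - x)%R id B setT) => //.
- exact: (mk (fun _ y => y - x)%R).
- by rewrite fine_ge0.
move=> z; rewrite -PB setTI.
have -> : B `&` (fun X : path_space => (X k.+1 - x)%R) @^-1` [set z] =
          B `&` [set X | X k.+1 = (X k + z)%R].
  apply/seteqP; split=> X [BX /=] h; split=> //; move: BX h => [_ [/= -> _]].
    by move=> <-; rewrite addrC subrK.
  by move=> ->; rewrite addrC addKr.
rewrite [LHS](prob_step z pB).
rewrite [LHS](_ : \int[Pr]_(X in B) _ =
  \int[Pr]_(X in B) cst ((omega x j : probability int R) [set z]) X); last first.
  by apply: eq_integral => X; rewrite inE => -[_ [/= -> ->]].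
by rewrite integral_cst// [LHS]muleC.
Qed.

End step_law.

Lemma nneseries_le_ub (R : realType) (u : (\bar R)^nat) c :
  (forall n, 0 <= u n) -> (forall n, \sum_(k < n) u k <= c) ->
  \sum_(k <oo) u k <= c.
Proof.
move=> u0 uc; apply: lime_le; first exact: is_cvg_nneseries.
by apply: nearW => n; rewrite big_mkord.
Qed.

Lemma measurable_fun_past d (T : measurableType d) n (A : set path_space)
    (F : path_space -> T) :
  (forall X Y : path_space, (forall k, (k <= n)%N -> X k = Y k) -> F X = F Y) ->
  measurable_fun A F.
Proof.
move=> FE mA B mB; apply: measurableI => //.
apply: (@past_measurable n); apply: past_determined => X Y XY /=.
by rewrite (FE X Y).
Qed.

Lemma past_le m n A : (m <= n)%N -> past m A -> past n A.
Proof.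
move=> mn; move: A; apply: smallest_sub.
  exact: (@sigma_algebra_measurable _ (g_sigma_algebraType _)).
move=> A; rewrite -bigcup_mkord_ord => -[k km [B mB <-]].
apply: sub_sigma_algebra; rewrite -bigcup_mkord_ord; exists k.
  exact: leq_trans km _.
exists B => //; congr (_ `&` _); apply/seteqP.
by split=> X /=; rewrite !inordK// (leq_trans km).
Qed.

(** * Optional stopping *)

Section avoidance.
Context (R : realType) (omega : environment R) (Pr : probability path_space R).
Hypothesis step : cookie_steps omega Pr.

Lemma measurable_always n (G : pred int) :
  measurable [set X : path_space | forall k, (n <= k)%N -> G (X k)].
Proof.
rewrite (_ : [set _ | _] =
    \bigcap_(k in [set k | (n <= k)%N]) [set X : path_space | G (X k)]).
  apply: bigcap_measurable; first by exists n => /=.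
  move=> k _; apply: (@past_measurable k); apply: past_determined => X Y XY /=.
  by rewrite XY.
by apply/seteqP; split=> X h k; exact: h.
Qed.

(* Up to the cost q of the cookies, psi is superharmonic on the window s; psi is
   at least 1 wherever the walk may leave s without entering G. *)
Lemma avoid_le (H : set path_space) m x0 (s : seq int) (G : pred int)
    (psi : int -> R) (q : int -> nat -> \bar R) M :
  past m H -> H `<=` [set X | X m = x0] -> x0 \in s -> uniq s ->
  (forall y, (0 <= psi y)%R) ->
  (forall y, y \notin s -> ~~ G y -> (1 <= psi y)%R) ->
  (forall x j, 0 <= q x j) -> (forall x j, (M <= j)%N -> q x j = 0) ->
  (forall x j, x \in s ->
     \int[omega x j : probability int R]_z (psi (x + z)%R)%:E <=
     (psi x)%:E + q x j) ->
  Pr [set X | forall k, (m <= k)%N -> X k \in s] = 0 ->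
  Pr (H `&` [set X | forall k, (m <= k)%N -> ~~ G (X k)]) <=
  ((psi x0)%:E + \sum_(x <- s) \sum_(j < M) q x j) * Pr H.
Proof.
move=> pH HX x0s us psi0 psi1 q0 qM psiq stay.
set Q := \sum_(x <- s) _.
pose In n := H `&` [set X | forall k, (m <= k <= m + n)%N -> X k \in s].
pose Ex n := In n `&` [set X : path_space | X (m + n).+1 \notin s /\ ~~ G (X (m + n).+1)].
have pIn n : past (m + n) (In n).
  apply: pastI; first by apply: past_le pH; exact: leq_addr.
  apply: past_determined => X Y XY Xs k /andP[mk kn].
  by rewrite -XY// Xs// mk.
have mIn n := past_measurable (pIn n).
have mEx n : measurable (Ex n).
  apply: measurableI => //; apply: (@past_measurable (m + n).+1).
  by apply: past_determined => X Y XY /=; rewrite XY.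
have mH := past_measurable pH.
(* Cookies outside the window cost nothing, so that [sum_used_cookies] charges only the stacks in
   [s]. *)
pose q' x j := if x \in s then q x j else 0.
have q'0 x j : 0 <= q' x j by rewrite /q'; case: ifP.
pose u n (X : path_space) := q' (X (m + n)%N) (visits X (m + n)%N (X (m + n)%N)).
have mu n A : measurable_fun A (u n).
  apply: (@measurable_fun_past _ _ (m + n)) => X Y XY; rewrite /u XY//.
  by rewrite (@eq_visits X Y)// => k /ltnW; exact: XY.
have mpsi k A : measurable_fun A (fun X : path_space => (psi (X k))%:E).
  by apply: (@measurable_fun_past _ _ k) => X Y XY; rewrite XY.
have psi0E y : 0 <= (psi y)%:E by rewrite lee_fin.
(* Stopped supermartingale inequality: the potential of the surviving paths plus the mass of the bad
   exits is at most the initial potential plus the cost of the window cookies used from time [m]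
   on. *)
have ind n : \int[Pr]_(X in In n) (psi (X (m + n)%N))%:E + \sum_(k < n) Pr (Ex k)
    <= (psi x0)%:E * Pr H + \sum_(k < n) \int[Pr]_(X in H) u k X.
  elim: n => [|n IH].
    rewrite !big_ord0 !adde0 -integral_cst// addn0.
    rewrite (@eq_integral _ _ _ Pr _ (cst (psi x0)%:E)); last first.
      by move=> X; rewrite inE => -[/HX/= ->].
    apply: ge0_subset_integral => //.
      by move=> *; exact: psi0E.
    by move=> X [].
  rewrite !big_ord_recr/= [X in _ + X]addeC addeA [leRHS]addeA.
  (* At a bad exit [psi] is at least 1, so the mass of [Ex n] is paid for by the potential after the
     step. *)
  have st : \int[Pr]_(X in In n.+1) (psi (X (m + n.+1)%N))%:E + Pr (Ex n) <=
      \int[Pr]_(X in In n) (psi (X (m + n)%N))%:E + \int[Pr]_(X in H) u n X.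
    apply: (@le_trans _ _ (\int[Pr]_(X in In n) (psi (X (m + n).+1))%:E)).
      apply: (@le_trans _ _ (\int[Pr]_(X in In n.+1 `|` Ex n) (psi (X (m + n).+1))%:E)).
        rewrite ge0_integral_setU//.
          rewrite addnS leeD2l// -[leLHS]mul1e -integral_cst//.
          apply: ge0_le_integral => //.
          by move=> X [_ [Xs XG]]; rewrite lee_fin psi1.
        apply/disj_setPS => X [[_ Xs] [_ []]]; rewrite Xs//.
        by rewrite addnS leqnn -addnS leq_addr.
      apply: ge0_subset_integral => //.
        by apply: measurableU => //; exact: mIn.
      move=> X [[HX' Xs]|[]//]; split=> // k /andP[mk kn].
      by rewrite Xs// mk addnS ltnW.
    have := one_step step (pIn n) (phi := fun x z => (psi (x + z)%R)%:E) (fun x z => psi0E _).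
    under eq_integral do rewrite addrC subrK.
    move=> ->.
    apply: (@le_trans _ _ (\int[Pr]_(X in In n) ((psi (X (m + n)%N))%:E + u n X))).
      apply: ge0_le_integral => //.
      - by move=> X _; exact: integral_ge0.
      - apply: (@measurable_fun_past _ _ (m + n)) => X Y XY; rewrite XY//.
        by rewrite (@eq_visits X Y)// => k /ltnW; exact: XY.
      - exact: emeasurable_funD.
      - move=> X [_ Xs]; have Xns : X (m + n)%N \in s by rewrite Xs// leq_addr leqnn.
        by rewrite /u /q' Xns psiq.
    rewrite ge0_integralD//; last by move=> *; exact: q'0.
    apply: leeD2l; apply: ge0_subset_integral => //.
      by move=> *; exact: q'0.
    by move=> X [].
  apply: (@le_trans _ _ (\int[Pr]_(X in In n) (psi (X (m + n)%N))%:E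
     + \int[Pr]_(X in H) u n X + \sum_(k < n) Pr (Ex k))); first exact: leeD2r.
  by rewrite addeAC; exact: leeD2r.
(* The cookies used before time [m] are counted as well, so the bound by the whole content [Q] of
   the window holds whatever the history [H]. *)
have usum n : \sum_(k < n) \int[Pr]_(X in H) u k X <= Q * Pr H.
  rewrite -ge0_integral_sum//; last by move=> *; exact: q'0.
  rewrite -integral_cst//; apply: ge0_le_integral => //.
  - by move=> X _; apply: sume_ge0 => k _; exact: q'0.
  - exact: emeasurable_sum.
  - move=> X _; apply: (@le_trans _ _ (\sum_(k < m + n) q' (X k) (visits X k (X k)))).
      by rewrite big_split_ord/= leeDr//; apply: sume_ge0 => k _; exact: q'0.
    apply: le_trans (@sum_used_cookies _ M q' s X (m + n) us q'0 _ _) _.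
    + by move=> x j Mj; rewrite /q' qM//; case: ifP.
    + by move=> k _ Xs; rewrite /q' (negbTE Xs).
    + by rewrite /Q big_seq [leRHS]big_seq lee_sum// => x xs; rewrite /q' xs.
have mst := measurable_always m (mem s).
have mG := measurable_always m (predC G).
apply: (@le_trans _ _ (\sum_(k <oo) Pr (Ex k))); last first.
  apply: nneseries_le_ub => // n; rewrite ge0_muleDl//; last first.
    by rewrite sume_ge0// => x _; rewrite sume_ge0.
  apply: le_trans (leeD2l _ (usum n)); apply: le_trans (ind n).
  by rewrite leeDr// integral_ge0.
(* A path that avoids [G] either stays in the window forever, a null event by [stay], or makes a bad
   exit at its first time outside. *)
apply: (@le_trans _ _
  (Pr ([set X : path_space | forall k, (m <= k)%N -> X k \in s] `|` \bigcup_k Ex k))).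
  apply: le_measure; rewrite ?inE.
  - exact: measurableI.
  - by apply: measurableU => //; exact: bigcup_measurable.
  move=> X [HX' XG].
  have [st|/existsNP[k /not_implyP[mk Xk]]] :=
    pselect (forall k, (m <= k)%N -> X k \in s); [by left|right].
  have ex : exists k, (m <= k)%N && (X k \notin s).
    by exists k; rewrite mk; apply/negP.
  case: (ex_minnP ex) => k0 /andP[mk0 Xk0] k0min.
  have mk0' : (m < k0)%N.
    rewrite ltn_neqAle mk0 andbT; apply/eqP => mE; move: Xk0.
    by rewrite -mE HX// x0s.
  exists (k0.-1 - m)%N => //.
  have E : (m + (k0.-1 - m))%N = k0.-1 by lia.
  have Ek : k0.-1.+1 = k0 by lia.
  split; last by rewrite E Ek; split => //; exact: XG.
  split=> // i; rewrite E => /andP[mi ik].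
  apply: contraT => Xi; suff : (k0 <= i)%N by lia.
  by apply: k0min; rewrite mi.
apply: le_trans (measureU2 _ _ _) _ => //; first exact: bigcup_measurable.
rewrite [X in X + _]stay add0e; apply: measure_sigma_subadditive => //.
exact: bigcup_measurable.
Qed.
End avoidance.

(** * Recurrence of sites and large jumps *)

Lemma ae_forall_countable d (T : measurableType d) (R : realType)
    (m : {measure set T -> \bar R}) (I : countType) (Q : I -> T -> Prop) :
  (forall i, {ae m, forall x, Q i x}) -> {ae m, forall x, forall i, Q i x}.
Proof.
move=> aeQ; pose Q' n x := if @unpickle I n is Some i then Q i x else True.
have : {ae m, forall x n, Q' n x}.
  apply: ae_foralln => n; rewrite /Q'; case: unpickle => [i|]; first exact: aeQ.
  exact: aeW.
by apply: filterS => x Qx i; have := Qx (pickle i); rewrite /Q' pickleK.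
Qed.

Definition io (X : path_space) (x : int) : Prop :=
  forall n, exists k, (n <= k)%N /\ X k = x.

Lemma io_visits X x M : io X x -> exists n, (M <= visits X n x)%N.
Proof.
move=> Xx; elim: M => [|M [n Mn]]; first by exists 0%N.
have [k [nk Xk]] := Xx n; exists k.+1.
by rewrite visitsS Xk eqxx addn1 ltnS (leq_trans Mn)// leq_visits.
Qed.

(** Pigeonhole: if the head of the list is visited finitely often, all later returns to the list are
    to its tail. *)
Lemma finite_io (X : path_space) (s : seq int) :
  (forall n, exists k, (n <= k)%N /\ X k \in s) -> exists2 x, x \in s & io X x.
Proof.
elim: s => [/(_ 0%N)[k []]//|x s IH] Xs.
have [Xx|/existsNP[n0 n0P]] := pselect (io X x).
  by exists x; rewrite ?mem_head.
have [n|y ys Xy] := IH; last by exists y => //; rewrite inE ys orbT.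
have [k [nk]] := Xs (maxn n n0).
rewrite inE => /orP[/eqP Xk|Xk]; last by exists k; split=> //; lia.
by exfalso; apply: n0P; exists k; split=> //; lia.
Qed.

Section recurrence.
Context (R : realType) (omega : environment R) (Pr : probability path_space R).
Hypothesis step : cookie_steps omega Pr.

(** Conditioning on the history up to time [n + m] bounds [Pr E] by [c] times the probability of the
    finite-time event [Em m]. As [m] grows this becomes [Pr E <= c * Pr E]. *)
Lemma never_eq0 (G : pred int) (c : R) : (0 <= c < 1)%R ->
  (forall m x0 H, past m H -> H `<=` [set X | X m = x0] ->
     Pr (H `&` [set X | forall k, (m <= k)%N -> ~~ G (X k)]) <= c%:E * Pr H) ->
  forall n, Pr [set X | forall k, (n <= k)%N -> ~~ G (X k)] = 0.
Proof.
move=> /andP[c0 c1] cG n.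
set E : set path_space := [set X | _].
pose Em m := [set X : path_space | forall k, (n <= k <= n + m)%N -> ~~ G (X k)].
have pEm m : past (n + m) (Em m).
  by apply: past_determined => X Y XY XG k /andP[nk km]; rewrite -XY// XG// nk.
have mEm m := past_measurable (pEm m).
have mE : measurable E by exact: (measurable_always n (predC G)).
have EEm m : Pr E <= c%:E * Pr (Em m).
  apply: (@le_measure_fibers _ _ _ _ Pr (fun X : path_space => X (n + m)%N)) => //.
    move=> i; apply: (@past_measurable (n + m)).
    exact: past_coord.
  move=> i.
  have pH : past (n + m) (Em m `&` (fun X : path_space => X (n + m)%N) @^-1` [set i]).
    by apply: pastI => //; exact: past_coord.
  apply: le_trans (cG (n + m)%N i _ pH _); last by move=> X [].
  apply: le_measure; rewrite ?inE.
  - by apply: measurableI => //; apply: (@past_measurable (n + m)); exact: past_coord.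
  - apply: measurableI; first exact: past_measurable pH.
    exact: (measurable_always _ (predC G)).
  - move=> X [XE Xi]; split; first by split=> // k /andP[nk _]; exact: XE.
    by move=> k nk; apply: XE; rewrite (leq_trans _ nk)// leq_addr.
have cvgE : Pr (Em m) @[m --> \oo] --> Pr E.
  have EE : E = \bigcap_m Em m.
    apply/seteqP; split=> [X XE m _ k /andP[nk _]|X XE k nk]; first exact: XE.
    by apply: (XE (k - n)%N I); rewrite nk subnKC /=.
  rewrite EE.
  apply: nonincreasing_cvg_mu => //.
  - by rewrite (le_lt_trans (probability_le1 _ _)) ?ltry.
  - by rewrite -EE.
  - apply/nonincreasing_seqP => m; apply/subsetPset => X XE k /andP[nk km].
    by apply: XE; rewrite nk addnS leqW.
have fE : Pr E \is a fin_num by exact: fin_num_measure.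
have Ec : Pr E <= c%:E * Pr E.
  apply: (@cvge_to_ge _ _ _ _ (fun m => c%:E * Pr (Em m)) (Pr E) _ (cvgeZl _ cvgE)) => //.
  exact: nearW.
have E0 : 0 <= Pr E by [].
move: Ec E0; rewrite -(fineK fE) -EFinM !lee_fin => Ec E0.
by congr EFin; apply/eqP; rewrite eq_le E0 andbT; nra.
Qed.

Section irreducible.
Context (mu : probability int R) (M : nat).
Hypothesis omega_mu :
  forall x j, (M <= j)%N -> (omega x j : probability int R) = mu.

(** Conditional Borel-Cantelli by disjointness. [A n t] is a visit to [x] with at least [M] earlier
    visits there and no jump by [z] from [x] since time [n]; [B n t] adds such a jump at time [t].
    The [B n t] are disjoint in [t] and have probability [mu [set z] * Pr (A n t)], so the
    probabilities of the [A n t] are summable. *)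
Lemma io_step x z : mu [set z] != 0 ->
  {ae Pr, forall X, io X x -> io X (x + z)%R}.
Proof.
move=> muz.
pose A n t := [set X : path_space | [/\ X t = x, (M <= visits X t x)%N, (n <= t)%N
  & forall k, (n <= k < t)%N -> X k = x -> X k.+1 <> (x + z)%R]].
have pA n t : past t (A n t).
  apply: past_determined => X Y XY [Xt Mt nt XA]; split => //.
  - by rewrite -XY.
  - by rewrite -(@eq_visits X)// => k /ltnW; exact: XY.
  - by move=> k /andP[nk kt]; rewrite -!XY ?(ltnW kt)//; apply: XA; rewrite nk.
have mA n t := past_measurable (pA n t).
pose B n t := A n t `&` [set X | X t.+1 = (X t + z)%R].
have mB n t : measurable (B n t).
  apply: measurableI => //; apply: (@past_measurable t.+1).
  by apply: past_determined => X Y XY /=; rewrite !XY.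
have PB n t : Pr (B n t) = mu [set z] * Pr (A n t).
  rewrite (prob_step step z (pA n t)) -integral_cst//; apply: eq_integral => X.
  by rewrite inE => -[Xt Mt _ _]; rewrite omega_mu// Xt.
have tB n : trivIset setT (B n).
  apply/trivIsetP => i j _ _; wlog ij : i j / (i < j)%N.
    move=> h; rewrite neq_ltn => /orP[ij|ji]; first by apply: h => //; rewrite neq_ltn ij.
    by rewrite setIC; apply: h => //; rewrite neq_ltn ji.
  move=> _; apply/seteqP; split=> // X [[[Xi _ ni _] /= Xi1] [[_ _ _ XA] _]].
  by apply: (XA i) => //; rewrite ?ni// Xi1 Xi.
have sA n : \sum_(t <oo) Pr (A n t) < +oo.
  have p0 : 0 < mu [set z] by rewrite lt0e muz measure_ge0.
  have fp : mu [set z] \is a fin_num by exact: fin_num_measure.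
  have : mu [set z] * \sum_(t <oo) Pr (A n t) <= 1.
    rewrite -(fineK fp) -nneseriesZl// fineK//.
    under eq_eseriesr do rewrite -PB.
    rewrite -measure_semi_bigcup//; last exact: bigcup_measurable.
    by apply: probability_le1; exact: bigcup_measurable.
  rewrite ltey; apply: contraTneq => ->.
  by rewrite gt0_muley// -ltNge ltry.
have : {ae Pr, forall X n, ~ lim_sup_set (A n) X}.
  apply: ae_foralln => n; exists (lim_sup_set (A n)); split.
  - by apply: bigcap_measurable => // k _; exact: bigcup_measurable.
  - exact: (lim_sup_set_cvg0 (mA n) (sA n)).
  - by move=> X /= /contrapT.
apply: filterS => X nA Xx n; apply: contrapT => nXz.
(* If [x + z] is not visited from time [n] on, every late visit to [x] realises [A n t], against
   Borel-Cantelli. *)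
have {}nXz k : (n <= k)%N -> X k <> (x + z)%R.
  by move=> nk Xk; apply: nXz; exists k.
apply: (nA n) => m _.
have [k0 Mk0] := io_visits M Xx.
have [k [kk Xk]] := Xx (maxn m (maxn n k0)).
exists k => /=; first by lia.
split=> //; [|lia|].
  by apply: leq_trans Mk0 _; apply: leq_visits; lia.
by move=> i /andP[ni ik] _; apply: nXz; lia.
Qed.

End irreducible.

(** Borel-Cantelli: the expected number of long jumps is the expectation of [F] summed over the used
    cookies, and no cookie is used twice. *)
Lemma large_jumps_finite (Bd : nat) (c : R) (M : nat) (F : int -> nat -> \bar R) :
  (forall x j, F x j =
     if (Bd < `|x|)%N then
       (omega x j : probability int R) [set z | (`|x| <= `|z|)%N] else 0) ->
  (forall x j, (M <= j)%N -> F x j = 0) ->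
  (forall V, \sum_(i < V.*2) \sum_(j < M) F (i%:Z - V%:Z)%R j <= c%:E) ->
  {ae Pr, forall X, exists n, forall k, (n <= k)%N -> (Bd < `|X k|)%N ->
     (`|X k.+1 - X k| < `|X k|)%N}.
Proof.
move=> FE FM Fc.
pose C k := [set X : path_space | (Bd < `|X k|)%N && (`|X k| <= `|(X k.+1 - X k)%R|)%N].
have mC k : measurable (C k).
  apply: (@past_measurable k.+1); apply: past_determined => X Y XY /=.
  by rewrite /C /= !XY.
have F0 x j : 0 <= F x j by rewrite FE; case: ifP.
pose u k (X : path_space) := F (X k) (visits X k (X k)).
have mu k A : measurable_fun A (u k).
  apply: (@measurable_fun_past _ _ k) => X Y XY; rewrite /u XY//.
  by rewrite (@eq_visits X Y)// => i /ltnW; exact: XY.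
have PC k : Pr (C k) = \int[Pr]_X u k X.
  pose phi (x z : int) : \bar R := (\1_[set z : int | (Bd < `|x|)%N && (`|x| <= `|z|)%N] z)%:E.
  rewrite -(setIT (C k)) -integral_indic//.
  have := @one_step _ _ _ step k setT phi.
  have -> : \int[Pr]_(X in setT) phi (X k) (X k.+1 - X k)%R = \int[Pr]_X (\1_(C k) X)%:E.
    by apply: eq_integral => X _; rewrite /phi !indicE.
  move=> ->.
  - apply: eq_integral => X _; rewrite /u FE /phi integral_indic// setIT.
    case: ifP => h; first by congr (_ _); apply/seteqP; split.
    by rewrite (_ : [set z | _] = set0)//; apply/seteqP; split.
  - by apply: past_determined.
  - by move=> x z; rewrite lee_fin.
have : Pr (lim_sup_set C) = 0.
  apply: lim_sup_set_cvg0 => //.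
  apply: (@le_lt_trans _ _ c%:E); last by rewrite ltry.
  apply: nneseries_le_ub => // n.
  rewrite (eq_bigr _ (fun (k : 'I_n) _ => PC k)).
  rewrite -ge0_integral_sum//; last by move=> *; exact: F0.
  rewrite -[leRHS]mule1 -(@probability_setT _ _ _ Pr) -integral_cst//.
  apply: ge0_le_integral => //.
  - by move=> X _; apply: sume_ge0 => k _; exact: F0.
  - exact: emeasurable_sum.
  (* The window [[-V, V)] depends on the path, but the bound [c] is uniform in [V]. *)
  - move=> X _; pose V := (\sum_(k < n) `|X k|).+1%N.
    have VX k : (k < n)%N -> (`|X k| < V)%N.
      by move=> kn; rewrite ltnS (bigD1 (Ordinal kn))//= leq_addr.
    apply: le_trans (Fc V).
    rewrite -(big_mkord xpredT (fun i => \sum_(j < M) F (i%:Z - V%:Z)%R j)).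
    rewrite -(big_map (fun i : nat => (i%:Z - V%:Z)%R) xpredT (fun x => \sum_(j < M) F x j)).
    apply: sum_used_cookies => //.
      by rewrite map_inj_uniq ?iota_uniq// => i j; lia.
    move=> k kn; rewrite FE => /negP nX; exfalso; apply: nX.
    have := VX k kn => XV; apply/mapP; exists `|(X k + V%:Z)%R|%N; last by lia.
    by rewrite mem_index_iota; lia.
move=> C0; exists (lim_sup_set C); split => //.
  by apply: bigcap_measurable => // k _; exact: bigcup_measurable.
move=> X /= /forallNP h n _.
have /existsNP[k /not_implyP[nk /not_implyP[Bk Xk]]] := h n.
by exists k => //=; rewrite /C /= Bk leqNgt; apply/negP.
Qed.

End recurrence.

(** The translations [V] that map [I] into itself form a semigroup containing [S]. Elements of both
    signs make it a group, so it consists of the multiples of its least positive element [k], and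
    the span condition forces [k = 1]. *)
Lemma semigroup_orbit_full (I S : set int) :
  I !=set0 -> (forall x z, I x -> S z -> I (x + z)%R) ->
  (exists2 p, S p & (0 < p)%R) -> (exists2 p, S p & (p < 0)%R) ->
  (forall k : int, (2 <= k)%R -> ~ S `<=` [set z | (k %| z)%Z]) ->
  forall y, I y.
Proof.
move=> [x0 Ix0] IS [p Sp p0] [q Sq q0] span y.
pose V := [set v | forall x, I x -> I (x + v)%R].
have SV : S `<=` V by move=> z Sz x Ix; exact: IS.
have VD v w : V v -> V w -> V (v + w)%R.
  by move=> Vv Vw x Ix; rewrite addrA; apply: Vw; exact: Vv.
have V0 : V 0%R by move=> x; rewrite addr0.
have Vn v n : V v -> V (v *+ n)%R.
  by move=> Vv; elim: n => [|n IH]; rewrite ?mulr0n// mulrS; exact: VD.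
have VN v : V v -> V (- v)%R.
  move=> Vv; have [v0|v0|->] := ltgtP v 0%R; last by rewrite oppr0.
    (* Adding [p - 1] copies of the negative [v] to [|v|] copies of the positive [p] leaves [- v];
       for positive [v] the negative [q] does the same. *)
    rewrite (_ : (- v = v *+ (`|p|.-1) + p *+ `|v|)%R); last first.
      rewrite -[(v *+ _)%R]mulr_natr -[(p *+ _)%R]mulr_natr !natz.
      rewrite (_ : `|p|.-1%:Z = p - 1)%R; last by lia.
      by rewrite (_ : `|v|%N%:Z = - v)%R; [ring|lia].
    by apply: VD; apply: Vn => //; exact: SV.
  rewrite (_ : (- v = v *+ (`|q|.-1) + q *+ `|v|)%R); last first.
    rewrite -[(v *+ _)%R]mulr_natr -[(q *+ _)%R]mulr_natr !natz.
    rewrite (_ : `|q|.-1%:Z = - q - 1)%R; last by lia.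
    by rewrite (_ : `|v|%N%:Z = v)%R; [ring|lia].
  by apply: VD; apply: Vn => //; exact: SV.
have Vz v m : V v -> V (v * m)%R.
  move=> Vv; case: (intP m) => [|n|n]; first by rewrite mulr0.
    by rewrite -natz mulr_natr; exact: Vn.
  by rewrite mulrN; apply: VN; rewrite -natz mulr_natr; exact: Vn.
have ex : exists n : nat, (0 < n)%N && `[< V n%:Z >].
  exists `|p|%N; apply/andP; split; first by lia.
  by apply/asboolP; rewrite gez0_abs ?ltW//; exact: SV.
case: (ex_minnP ex) => k /andP[k0 /asboolP Vk] kmin.
have kV v : V v -> (k%:Z %| v)%Z.
  move=> Vv; apply/eqP; apply/eqP; rewrite -[_ == _]negbK; apply/negP => vk.
  have Vm : V (v %% k%:Z)%Z.
    have -> : ((v %% k%:Z)%Z = v + k%:Z * - (v %/ k%:Z)%Z)%R.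
      by rewrite {2}(divz_eq v k%:Z); ring.
    by apply: VD => //; exact: Vz.
  have := kmin `|(v %% k%:Z)%Z|%N.
  rewrite gez0_abs ?modz_ge0//; last by lia.
  have := ltz_pmod v (_ : (0 < k%:Z)%R); have := modz_ge0 v (_ : (k%:Z != 0)%R).
  move=> /(_ ltac:(lia)) m0 /(_ ltac:(lia)) mk; move: vk => /dvdz_mod0P vk.
  have m1 : (0 < `|(v %% k%:Z)%Z|)%N by lia.
  by rewrite m1 asboolT//= => /(_ isT); lia.
have k1 : k = 1%N.
  have [//|k2|] := ltngtP k 1%N; [lia| |by []].
  exfalso; apply: (span k%:Z); first by lia.
  by move=> z Sz; exact/kV/SV.
rewrite (_ : y = x0 + (1 * (y - x0)))%R; last by ring.
by apply: Vz => //; rewrite -[1%R]/(1%N%:Z) -k1.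
Qed.

(** * Support of a centred step distribution *)

Section step_distribution.
Context (R : realType).
Implicit Types nu : probability int R.

Lemma ae_support nu : {ae nu, forall z, Defs.support nu z}.
Proof.
have : {ae nu, forall z i, z = i -> Defs.support nu i}.
  apply: ae_forall_countable => i.
  have [nui|nui] := eqVneq (nu [set i]) 0; last by apply: aeW => z _.
  by exists [set i]; split=> // z /= /not_implyP[-> _].
by apply: filterS => z /(_ z erefl).
Qed.

(** When [s * z] has a constant sign on the support, the integral of [|s * z|] is [s] times the
    mean, hence 0, so [z = 0] almost everywhere. *)
Lemma support_signed nu (s : int) : has_mean nu -> mean nu = 0 -> s != 0%R ->
  (forall z, Defs.support nu z -> (0 <= s * z)%R) -> Defs.support nu `<=` [set 0%R].
Proof.
move=> hm mean0 s0 posz.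
pose f (z : int) : \bar R := ((s * z)%R%:~R)%:E.
have If : \int[nu]_z `|f z| = 0.
  rewrite (@ae_eq_integral _ _ _ nu setT f)//; last first.
    move: (ae_support nu); apply: filterS => z /posz sz _.
    by rewrite gee0_abs// lee_fin ler0z.
  rewrite /f; under eq_integral do rewrite intrM EFinM.
  rewrite integralZl//.
  by move: mean0; rewrite /mean unlock => ->; rewrite mule0.
have : ae_eq nu setT f (cst 0) by apply/ae_eq_integral_abs.
move=> [N [_ N0 sN]] z /= nuz; apply: contrapT => z0.
move: nuz; rewrite /Defs.support/= => /negP; apply; rewrite -measure_le0 -N0.
apply: le_measure; rewrite ?inE// => _ ->; apply: sN => /= /(_ I).
by move=> [] /eqP; rewrite intr_eq0 mulf_eq0 (negbTE s0)/= => /eqP.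
Qed.

(** A centred law living on one side would be concentrated at 0, which is a multiple of 2, against
    the span condition. *)
Lemma support_pos_neg nu : has_mean nu -> mean nu = 0 -> span_one nu ->
  (exists2 p, Defs.support nu p & (0 < p)%R) /\ (exists2 p, Defs.support nu p & (p < 0)%R).
Proof.
move=> hm m0 span.
have nS : ~ Defs.support nu `<=` [set 0%R].
  by move=> S0; apply: (span 2%R) => // z /S0 ->.
split; apply: contrapT => nP; apply: nS.
  apply: (support_signed (s := (-1)%R)) => // z Sz; rewrite mulN1r oppr_ge0 leNgt.
  by apply/negP => z0; apply: nP; exists z.
apply: (support_signed (s := 1%R)) => // z Sz; rewrite mul1r leNgt.
by apply/negP => z0; apply: nP; exists z.
Qed.

End step_distribution.

(** * Exit from a window *)

Section exit_estimate.
Context (R : realType).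
Implicit Types nu : probability int R.

(** The price of cutting a ramp off at 0, at points at distance at least [K] above the cut. *)
Definition excess (K : nat) nu : \bar R :=
  \int[nu]_z (Num.max 0 (`|z|%:~R - K%:R))%R%:E.

Lemma excess_ge0 K nu : 0 <= excess K nu.
Proof. by apply: integral_ge0 => z _; rewrite lee_fin le_max lexx. Qed.

Lemma integrable_excess K nu : has_mean nu ->
  nu.-integrable setT (fun z : int => (Num.max 0 (`|z|%:~R - K%:R))%R%:E).
Proof.
move=> hm; apply: le_integrable hm => //= z _.
rewrite lee_fin ger0_norm ?le_max ?lexx// -intr_norm.
by rewrite ge_max ler0z normr_ge0/= gerBl.
Qed.

(* A ramp of slope 1/D, cut off at 0 and 1, is harmonic up to the drift and to the
   part of the jumps that exceeds K, at points at distance K from the lower cut. *)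
Lemma ramp_le nu (s : int) (K D : nat) (u : int) : has_mean nu ->
  s = 1%R \/ s = (-1)%R -> (0 < D)%N -> (K%:Z <= u)%R ->
  \int[nu]_z (Num.min 1 (Num.max 0 ((u + s * z)%R%:~R / D%:R)))%R%:E <=
  (u%:~R / D%:R)%R%:E +
    (D%:R^-1)%R%:E * ((s%:~R)%R%:E * mean nu + excess K nu).
Proof.
move=> hm s1 D0 Ku.
have D0' : (0 < (D%:R : R))%R by rewrite ltr0n.
have Iz : nu.-integrable setT (fun z : int => (s%:~R)%:E * (z%:~R : R)%:E).
  exact: integrableZl.
have Ie := integrable_excess K hm.
have Ic : nu.-integrable setT (cst (u%:~R : R)%:E).
  exact: finite_measure_integrable_cst.
rewrite (_ : _ + _ = \int[nu]_z ((D%:R^-1)%R%:E *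
  (cst (u%:~R : R)%:E z + ((s%:~R)%R%:E * (z%:~R : R)%:E
    + (Num.max 0 (`|z|%:~R - K%:R))%R%:E)))); last first.
  rewrite integralZl//; last by apply: integrableD => //; exact: integrableD.
  rewrite integralD//; last exact: integrableD.
  rewrite integralD// integralZl// integral_cst//.
  rewrite [X in (u%:~R)%:E * X]probability_setT mule1.
  rewrite /mean unlock /excess [RHS]muleDr//.
  by rewrite -EFinM mulrC.
apply: ge0_le_integral => //.
move=> z _.
(* The inequality holds pointwise: where [u + s * z] is negative, [K <= u] gives
   [- (u + s * z) <= |z| - K], so the excess makes up for the cut. *)
rewrite (_ : _ * _ = (D%:R^-1 * (u%:~R + (s%:~R * z%:~R +
  Num.max 0 (`|z|%:~R - K%:R))))%R%:E)// lee_fin ge_min; apply/orP; right.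
have Ku' : ((K%:R : R) <= u%:~R)%R by rewrite -[K%:R]/(K%:Z%:~R) ler_int.
have sz : (`|s%:~R * z%:~R| = `|z%:~R| :> R)%R.
  by case: s1 => ->; rewrite ?mulrN1z ?mulr1z ?mulN1r ?mul1r ?normrN.
have e0 : (0 <= Num.max 0 (`|z|%:~R - K%:R) :> R)%R by rewrite le_max lexx.
have e1 : (`|z|%:~R - K%:R <= Num.max 0 (`|z|%:~R - K%:R) :> R)%R.
  by rewrite le_max lexx orbT.
have zn : (`|z%:~R| = `|z|%:~R :> R)%R by rewrite -intr_norm.
have n1 := ler_norm (s%:~R * z%:~R : R)%R.
have n3 : (- (s%:~R * z%:~R) <= `|s%:~R * z%:~R| :> R)%R by rewrite -normrN ler_norm.
rewrite intrD intrM ge_max (mulrC D%:R^-1%R); apply/andP; split.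
  by apply: divr_ge0; [lra|exact: ltW].
by rewrite ler_pM2r ?invr_gt0//; lra.
Qed.

Definition window (l r N : nat) : seq int :=
  [seq (i%:Z - (l * N)%:Z)%R | i <- iota 0 ((l + r) * N).+1].

Lemma mem_window l r N y :
  (y \in window l r N) = (- (l * N)%:Z <= y <= (r * N)%:Z)%R.
Proof.
rewrite /window mulnDl; apply/mapP/idP => [[i]|].
  by rewrite mem_iota => + ->; lia.
by move=> yN; exists `|(y + (l * N)%:Z)%R|%N; [rewrite mem_iota|]; lia.
Qed.

Lemma window_uniq l r N : uniq (window l r N).
Proof. by rewrite map_inj_uniq ?iota_uniq// => i j; lia. Qed.

Section passage.
Context (omega : environment R) (Pr : probability path_space R).
Hypothesis step : cookie_steps omega Pr.

(* The walk leaves the window [-lN, rN] on the side towards which s decreases with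
   probability at least 1 - (k / (l + r) + gamma) - o(1), where k is l or r. *)
Lemma passage (s : int) (K l r M : nat) (gamma C : R) (c : int -> nat -> \bar R) :
  s = 1%R \/ s = (-1)%R -> (0 < l)%N -> (0 < r)%N ->
  (0 <= gamma)%R -> (0 <= C)%R ->
  ((if s == 1%R then l else r)%:R + gamma * (l + r)%:R < (l + r)%:R)%R ->
  (forall x j, has_mean (omega x j : probability int R)) ->
  (forall x j, 0 <= c x j) -> (forall x j, (M <= j)%N -> c x j = 0) ->
  (forall x j, s%:~R%:E * mean (omega x j : probability int R) +
     excess K (omega x j : probability int R) <= c x j) ->
  (forall m t, Pr [set X | forall k, (m <= k)%N -> X k \in (t : seq int)] = 0) ->
  (forall N0, exists2 N, (N0 <= N)%N &
     \sum_(x <- window l r N) \sum_(j < M) c x j <=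
       (gamma * ((l + r) * N)%:R + C)%:E) ->
  forall L n : nat, Pr [set X | forall k, (n <= k)%N -> ~~ (s * X k < - L%:Z)%R] = 0.
Proof.
move=> s1 l0 r0 g0 C0 gsmall hm c0 cM sc stay freq L n.
set a := if s == 1%R then l else r in gsmall *.
have a0 : (0 < a)%N by rewrite /a; case: ifP.
pose W := (l + r)%N; rewrite -/W in gsmall.
have W1 : (1 <= W%:R :> R)%R by rewrite ler1n addn_gt0 l0.
(* [rho] is half of the slack in [gsmall]; the other half will absorb [|x0|], [C] and [K] once [N]
   is large. *)
pose rho := ((W%:R - a%:R - gamma * W%:R) / 2 : R)%R.
have rho0 : (0 < rho)%R by rewrite /rho divr_gt0//; lra.
have rhoW : (rho < W%:R)%R.
  have ga : (0 <= a%:R :> R)%R by [].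
  have gW : (0 <= gamma * W%:R)%R by rewrite mulr_ge0.
  by rewrite /rho; lra.
pose c' := (1 - rho / W%:R)%R.
have c'01 : (0 <= c' < 1)%R.
  rewrite /c' subr_ge0 ler_pdivrMr ?mul1r ?ltW//=; last exact: lt_le_trans W1.
  by rewrite ltrBlDr ltrDl divr_gt0// (lt_le_trans _ W1).
apply: (never_eq0 (G := fun y => (s * y < - L%:Z)%R) c'01) => m x0 H pH HX.
(* Such an [N] puts [x0] into the window and the level [L] below [a * N], and makes [rho * N] at
   least [|x0| + C + rho * K]. *)
have [N N0N cN] := freq (`|x0| + L + ((Num.truncn ((`|x0|%:R + C) / rho)).+1 + K))%N.
have x0N : (`|x0| <= N)%N by apply: leq_trans N0N; rewrite -addnA leq_addr.
have LN : (L <= N)%N by apply: leq_trans N0N; rewrite addnAC leq_addl.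
have tN : ((Num.truncn ((`|x0|%:R + C) / rho)).+1 + K <= N)%N.
  by apply: leq_trans N0N; rewrite leq_addl.
have N_gt0 : (0 < N)%N by apply: leq_trans tN.
(* The ramp is as long as the window plus a margin [K] at the target end: on the window its
   numerator [u] stays between [K], as [ramp_le] requires, and [D], and past the opposite end the
   ramp equals 1. *)
pose D := (W * N + K)%N.
have D0 : (0 < D)%N by rewrite /D addn_gt0 muln_gt0 /W addn_gt0 l0 N_gt0.
pose u (y : int) : int := ((a * N + K)%:Z + s * y)%R.
pose psi (y : int) : R := Num.min 1%R (Num.max 0%R ((u y)%:~R / D%:R)%R).
pose q x j : \bar R := (D%:R^-1)%:E * c x j.
have D0' : (0 < (D%:R : R))%R by rewrite ltr0n.
have aN : (N <= a * N)%N by rewrite leq_pmull.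
have uP y : y \in window l r N -> (K%:Z <= u y)%R /\ (u y <= D%:Z)%R.
  rewrite mem_window /u /D /W /a mulnDl.
  by case: s1 => -> /=; rewrite ?mul1r ?mulN1r; clear; lia.
have psiE y : y \in window l r N -> psi y = ((u y)%:~R / D%:R)%R.
  move=> /uP[Ku uD]; rewrite /psi max_r ?min_r//.
    by rewrite ler_pdivrMr// mul1r -[D%:R]/(D%:Z%:~R) ler_int.
  by rewrite divr_ge0 ?ler0z ?ler0n//; lia.
have psi1 y : y \notin window l r N -> ~~ (s * y < - (a * N)%:Z)%R -> (1 <= psi y)%R.
  rewrite mem_window => yN Gy; rewrite /psi le_min lexx/= le_max; apply/orP; right.
  rewrite ler_pdivlMr// mul1r -[D%:R]/(D%:Z%:~R) ler_int; move: yN Gy.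
  rewrite /u /D /W /a mulnDl.
  by case: s1 => -> /=; rewrite ?mul1r ?mulN1r; clear; lia.
have x0W : x0 \in window l r N.
  rewrite mem_window.
  have lN : (N <= l * N)%N by rewrite leq_pmull.
  have rN : (N <= r * N)%N by rewrite leq_pmull.
  by move: x0N lN rN; clear; lia.
(* The target used here is the exit on the favourable side, beyond [a * N]; since [L <= N <= a * N],
   reaching it also passes the level [L]. *)
have := avoid_le step (G := fun y => (s * y < - (a * N)%:Z)%R) (psi := psi) (q := q)
  (M := M) pH HX x0W (window_uniq l r N) _ psi1 _ _ _ (stay m _).
have key : (psi x0)%:E + \sum_(x <- window l r N) \sum_(j < M) q x j <= c'%:E.
  have -> : \sum_(x <- window l r N) \sum_(j < M) q x j =
      (D%:R^-1)%:E * \sum_(x <- window l r N) \sum_(j < M) c x j.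
    rewrite ge0_sume_distrr; last by move=> x _; exact: sume_ge0.
    by apply: eq_bigr => x _; rewrite ge0_sume_distrr.
  apply: (@le_trans _ _ ((psi x0)%:E + (D%:R^-1)%:E * (gamma * (W * N)%:R + C)%:E)).
    by apply: leeD2l; rewrite lee_wpmul2l// lee_fin invr_ge0 ltW.
  rewrite -EFinM -EFinD lee_fin psiE// [(D%:R^-1 * _)%R]mulrC -mulrDl ler_pdivrMr//.
  have ux : ((u x0)%:~R <= a%:R * N%:R + K%:R + `|x0|%:R :> R)%R.
    rewrite -natrM -!natrD -[_%:R]/(_%:Z%:~R) ler_int /u.
    rewrite (PoszD (a * N + K)%N) lerD2l.
    by case: s1 => ->; rewrite ?mul1r ?mulN1r; clear; lia.
  have NC : ((`|x0|%:R + C) / rho + K%:R <= N%:R)%R.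
    apply: (@le_trans _ _ ((Num.truncn ((`|x0|%:R + C) / rho)).+1 + K)%N%:R).
      by rewrite natrD lerD2r ltW// truncnS_gt.
    by rewrite ler_nat.
  have {}NC : (`|x0|%:R + C + rho * K%:R <= rho * N%:R)%R.
    rewrite -(ler_pM2l rho0) in NC.
    by apply: le_trans NC; rewrite mulrDr mulrCA divff ?mulr1// gt_eqF.
  have KW : (rho * (K%:R / W%:R) <= rho * K%:R)%R.
    rewrite ler_pM2l// ler_pdivrMr ?ler_peMr//.
    exact: lt_le_trans W1.
  rewrite /D /c' (natrD _ (W * N)%N K) (natrM _ W N) mulrBl mul1r.
  have -> : (rho / W%:R * (W%:R * N%:R + K%:R) = rho * N%:R + rho * (K%:R / W%:R))%R.
    by field; rewrite gt_eqF// (lt_le_trans _ W1).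
  have rhoE : (rho * 2 = W%:R - a%:R - gamma * W%:R)%R by rewrite /rho; field.
  have rhoN : (rho * N%:R * 2 = W%:R * N%:R - a%:R * N%:R - gamma * (W%:R * N%:R))%R.
    by rewrite mulrAC rhoE; ring.
  have K0 : (0 <= K%:R :> R)%R by [].
  have rK : (0 <= rho * K%:R)%R by rewrite mulr_ge0// ltW.
  lra.
move=> h; apply: le_trans (le_trans (h _ _ _ _) _).
- apply: le_measure; rewrite ?inE.
  + apply: measurableI; first exact: past_measurable pH.
    exact: (measurable_always _ (fun y => ~~ (s * y < - L%:Z)%R)).
  + apply: measurableI; first exact: past_measurable pH.
    exact: (measurable_always _ (fun y => ~~ (s * y < - (a * N)%:Z)%R)).
  + move=> X [HX' XL]; split=> // k mk; apply: contra (XL k mk).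
    by move: LN aN; clear; lia.
- by move=> y; rewrite le_min ler01 le_max lexx.
- by move=> x j; rewrite mule_ge0// lee_fin invr_ge0 ltW.
- by move=> x j Mj; rewrite /q cM// mule0.
- move=> x j xW; rewrite psiE//.
  apply: le_trans (_ : _ <= (_ + (D%:R^-1)%R%:E * (s%:~R%:E * mean _ + excess K _))) _.
    apply: le_trans (ramp_le (hm x j) s1 D0 (proj1 (uP x xW))).
    rewrite le_eqVlt; apply/orP; left; apply/eqP; apply: eq_integral => z _.
    by rewrite /psi /u mulrDr addrA.
  by apply: leeD2l; rewrite lee_wpmul2l// lee_fin invr_ge0 ltW.
- exact: lee_wpmul2r.
Qed.
End passage.
End exit_estimate.

(** * The walk in a typical environment *)

(** If the path does not tend to [+oo], it crosses some level [L >= 0] upwards infinitely often.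
    Late crossings cannot start below [-Bd], as the jump would be longer than the distance to 0. So
    they start in a finite set, and some site is visited infinitely often. *)
Lemma crossing_dichotomy (R : realType) (X : path_space) (Bd : nat) :
  (forall n L : nat, exists k, (n <= k)%N /\ (L%:Z < X k)%R) ->
  (exists n, forall k, (n <= k)%N -> (Bd < `|X k|)%N ->
     (`|(X k.+1 - X k)%R| < `|X k|)%N) ->
  (forall x, io X x -> forall y, io X y) ->
  (forall y, io X y) \/ transient_right R X.
Proof.
move=> up [n0 jump] all.
have [tr|ntr] := pselect (forall L : nat, exists n, forall k, (n <= k)%N -> (L%:Z <= X k)%R).
  right; rewrite /transient_right/=; apply/cvgryPge => A.
  have [n nP] := tr (Num.truncn A).+1.
  exists n => // k /= nk; apply: le_trans (_ : (Num.truncn A).+1%:R <= _)%R.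
    exact/ltW/truncnS_gt.
  by rewrite -[_%:R]/(_%:Z%:~R) ler_int nP.
left; move: ntr => /existsNP[L /forallNP low].
have [|x _] := @finite_io X [seq (i%:Z - Bd%:Z)%R | i <- iota 0 (Bd + L).+1]; last exact: all.
move=> n.
have [k1 [nk1 Xk1]] : exists k1, (maxn n n0 <= k1)%N /\ (X k1 < L%:Z)%R.
  have /existsNP[k /not_implyP[nk Xk]] := low (maxn n n0).
  by exists k; split=> //; rewrite ltNge; apply/negP.
have [k2 [k12 Xk2]] := up k1 L.
have ex : exists k, (k1 <= k)%N && (L%:Z <= X k)%R by exists k2; rewrite k12 ltW.
case: (ex_minnP ex) => k /andP[k1k Xk] kmin.
have k1k' : (k1 < k)%N.
  by rewrite ltn_neqAle k1k andbT; apply: contraTneq Xk1 => ->; rewrite -leNgt.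
exists k.-1; split; first by lia.
have Xk' : (X k.-1 < L%:Z)%R.
  by rewrite ltNge; apply/negP => Xl; have := kmin k.-1; rewrite Xl andbT; lia.
have XB : (- Bd%:Z <= X k.-1)%R.
  rewrite leNgt; apply/negP => XB; have := jump k.-1.
  rewrite prednK; last by lia.
  by lia.
by apply/mapP; exists `|(X k.-1 + Bd%:Z)%R|%N; [rewrite mem_iota|]; lia.
Qed.

Lemma recurrent_io (R : realType) (X : path_space) :
  recurrent R X <-> forall x, io X x.
Proof.
split=> [Xr x n|Xio x].
  apply: contrapT => /forallNP nX.
  have : \sum_(0 <= k <oo) ((X k == x)%:R : R)%:E < +oo.
    rewrite (@nneseries_split _ _ 0 n)//.
    rewrite add0n [X in _ + X]eseries0 ?adde0; last first.
      move=> k nk _; case: eqP => // Xk; exfalso; apply: (nX k); split=> //.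
    by rewrite sumEFin ltry.
  by rewrite (Xr x) ltxx.
apply/eqyP => A A0.
pose m := (Num.truncn A).+1.
have [n mn] := @io_visits X x m (Xio x).
apply: (@le_trans _ _ (\sum_(0 <= k < n) ((X k == x)%:R : R)%:E)); last first.
  by apply: nneseries_lim_ge => k _ _; rewrite lee_fin.
rewrite big_mkord sumEFin lee_fin -natr_sum -[(\sum_(k < n) _)%N]/(visits X n x).
by apply: (@le_trans _ _ m%:R); [exact/ltW/truncnS_gt|rewrite ler_nat].
Qed.

Section quenched.
Context (R : realType) (omega : environment R) (Pr : probability path_space R).
Hypothesis step : cookie_steps omega Pr.
Context (mu : probability int R) (M : nat).
Hypothesis omega_mu :
  forall x j, (M <= j)%N -> (omega x j : probability int R) = mu.
Hypotheses (mu_mean : has_mean mu) (mu_mean0 : mean mu = 0) (mu_span : span_one mu).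

(** By [io_step] the set of sites visited infinitely often is almost surely closed under the steps
    of [mu], and [semigroup_orbit_full] applies to it. *)
Lemma io_all : {ae Pr, forall X x, io X x -> forall y, io X y}.
Proof.
have [pos neg] := support_pos_neg mu_mean mu_mean0 mu_span.
have : {ae Pr, forall X (xz : int * int), mu [set xz.2] != 0 ->
    io X xz.1 -> io X (xz.1 + xz.2)%R}.
  apply: ae_forall_countable => -[x z] /=.
  have [muz|muz] := eqVneq (mu [set z]) 0; first by apply: aeW => X.
  by have := io_step step omega_mu x muz; apply: filterS => X Xxz _.
apply: filterS => X Xio x Xx.
apply: (semigroup_orbit_full (I := io X) (S := Defs.support mu)) => //.
  by exists x.
by move=> y z Xy Sz; exact: (Xio (y, z)).
Qed.

(** A walk confined to a finite set visits one site infinitely often, hence by [io_all] also sites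
    outside the set. *)
Lemma stay_eq0 m (t : seq int) :
  Pr [set X | forall k, (m <= k)%N -> X k \in t] = 0.
Proof.
apply/eqP; rewrite -measure_le0.
have [N [mN N0 sN]] := io_all.
rewrite -N0; apply: le_measure; rewrite ?inE//.
  exact: (measurable_always m (mem t)).
move=> X Xt; apply: sN => /= Xall.
have [|x xt Xx] := @finite_io X t.
  by move=> n; exists (maxn m n); rewrite leq_maxr Xt// leq_maxl.
(* This site exceeds every element of [t] in absolute value. *)
have [k [mk Xk]] := Xall _ Xx (\sum_(y <- t) `|y|)%N.+1%:Z m.
have : (`|X k| <= \sum_(y <- t) `|y|)%N.
  by rewrite (big_rem (X k)) ?Xt//= leq_addr.
by rewrite Xk /= ltnn.
Qed.

Context (Bd : nat).
Hypothesis mu_bounded : mu [set z | (`|z| <= Bd)%N] = 1.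

Let mu_farC : mu (~` [set z | (`|z| <= Bd)%N]) = 0.
Proof. by rewrite probability_setC// mu_bounded subee. Qed.

Lemma excess_mu K : (Bd <= K)%N -> excess K mu = 0.
Proof.
move=> BK; rewrite /excess; apply/eqP; rewrite eq_le integral_ge0 ?andbT; last first.
  by move=> z _; rewrite lee_fin le_max lexx.
apply: (@le_trans _ _ (\int[mu]_(z in setT) cst 0 z)); last by rewrite integral0.
rewrite le_eqVlt; apply/orP; left; apply/eqP.
apply: ae_eq_integral => //.
exists (~` [set z | (`|z| <= Bd)%N]); split=> //.
move=> z /= nz zB; apply: nz => _ /=.
by congr EFin; apply: max_l; rewrite subr_le0 ler_nat (leq_trans zB).
Qed.

Lemma mu_far x : (Bd < `|x|)%N -> mu [set z | (`|x| <= `|z|)%N] = 0.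
Proof.
move=> Bx; apply/eqP; rewrite -measure_le0.
apply: (@le_trans _ _ (mu (~` [set z | (`|z| <= Bd)%N]))).
  by apply: le_measure; rewrite ?inE// => z /=; lia.
by rewrite mu_farC.
Qed.

Hypothesis omega_mean : forall x j, has_mean (omega x j : probability int R).
Hypothesis omega_mean_ge0 : forall x j, 0 <= mean (omega x j : probability int R).

(** Towards [+oo] the nonnegative drift helps, so [passage] with [s = -1] charges only the excess.
    The symmetric window requires [1 + 2 * gamma < 2], which [1 / 8] satisfies. *)
Lemma omega_recurrent_or_transient (K : nat) (C1 C2 : R) :
  (Bd <= K)%N -> (0 <= C1)%R ->
  (forall N0, exists2 N, (N0 <= N)%N &
     \sum_(x <- window 1 1 N) \sum_(j < M) excess K (omega x j : probability int R)
       <= (1 / 8 * ((1 + 1) * N)%:R + C1)%:E) ->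
  (forall V, \sum_(i < V.*2) \sum_(j < M)
     (omega (i%:Z - V%:Z)%R j : probability int R)
       [set z | (`|(i%:Z - V%:Z)%R| <= `|z|)%N] <= C2%:E) ->
  {ae Pr, forall X : path_space, (recurrent R `|` transient_right R) X}.
Proof.
move=> BK C10 freq jumps.
have up : {ae Pr, forall (X : path_space) (n L : nat), exists k, (n <= k)%N /\ (L%:Z < X k)%R}.
  apply: ae_foralln => n; apply: ae_foralln => L.
  have PL := @passage _ omega Pr step (-1)%R K 1 1 M (1 / 8)%R C1
    (fun x j => excess K (omega x j : probability int R)) _ _ _ _ _ _ omega_mean _ _ _
    stay_eq0 freq L n.
  exists [set X : path_space | forall k, (n <= k)%N -> ~~ (-1 * X k < - L%:Z)%R]; split.
  - exact: (measurable_always n (fun y => ~~ (-1 * y < - L%:Z)%R)).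
  - apply: PL => //.
    + by right.
    + by rewrite /= -[(1 + 1)%N]/2%N; lra.
    + by move=> x j; exact: excess_ge0.
    + by move=> x j Mj; rewrite omega_mu// excess_mu.
    + move=> x j; rewrite -[leRHS]add0e leeD2r//.
      by rewrite mulrN1z EFinN mulN1e oppe_le0.
  - move=> X /= /forallNP Xk k nk; apply/negP => Xlt; apply: (Xk k); split=> //.
    by move: Xlt; rewrite mulN1r ltrN2.
have jf : {ae Pr, forall X : path_space, exists n, forall k, (n <= k)%N -> (Bd < `|X k|)%N ->
     (`|(X k.+1 - X k)%R| < `|X k|)%N}.
  (* At distance more than [Bd] from 0, a cookie [mu] almost surely makes no jump as long as that
     distance, so only the first [M] cookies contribute. *)
  apply: (large_jumps_finite step (M := M) (c := C2) (F := fun x j =>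
     if (Bd < `|x|)%N then
       (omega x j : probability int R) [set z | (`|x| <= `|z|)%N] else 0)) => //.
    by move=> x j Mj; case: ifP => // Bx; rewrite omega_mu// mu_far.
  move=> V; apply: le_trans (jumps V); apply: lee_sum => i _; apply: lee_sum => j _.
  by case: ifP.
apply: filterS (filterI up (filterI jf io_all)) => X [{}up [{}jf all]].
have [Xio|Xtr] := crossing_dichotomy R up jf all; last by right.
by left; apply/recurrent_io.
Qed.

(** Now the drift works against the exit, so [passage] with [s = 1] charges mean and excess
    together; it makes the walk negative at arbitrarily late times. *)
Lemma omega_not_transient (K b : nat) (gamma C : R) :
  (Bd <= K)%N -> (0 < b)%N -> (0 <= gamma)%R -> (0 <= C)%R ->
  (1 + gamma * (1 + b)%:R < (1 + b)%:R)%R ->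
  (forall N0, exists2 N, (N0 <= N)%N &
     \sum_(x <- window 1 b N) \sum_(j < M)
         (mean (omega x j : probability int R) + excess K (omega x j : probability int R))
       <= (gamma * ((1 + b) * N)%:R + C)%:E) ->
  {ae Pr, forall X : path_space, ~ transient_right R X}.
Proof.
move=> BK b0 g0 C0 gb freq.
have down : {ae Pr, forall (X : path_space) (n : nat), exists k, (n <= k)%N /\ (X k < 0)%R}.
  apply: ae_foralln => n.
  have PL := @passage _ omega Pr step 1%R K 1 b M gamma C
    (fun x j => mean (omega x j : probability int R) + excess K (omega x j : probability int R))
    _ _ _ _ _ _ omega_mean _ _ _ stay_eq0 freq 0 n.
  exists [set X : path_space | forall k, (n <= k)%N -> ~~ (1 * X k < - 0%:Z)%R]; split.
  - exact: (measurable_always n (fun y => ~~ (1 * y < - 0%:Z)%R)).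
  - apply: PL => //.
    + by left.
    + by move=> x j; rewrite adde_ge0// excess_ge0.
    + by move=> x j Mj; rewrite omega_mu// excess_mu// mu_mean0 adde0.
    + by move=> x j; rewrite mul1e.
  - move=> X /= /forallNP Xk k nk; apply/negP => Xlt; apply: (Xk k); split=> //.
    by move: Xlt; rewrite mul1r oppr0.
move: down; apply: filterS => X down /cvgryPge /(_ 0%R)[n _ nP].
have [k [nk Xk]] := down n.
by have := nP k nk; rewrite /= ler0z leNgt Xk.
Qed.

End quenched.

(** * Stationary ergodic environments *)

Section ergodic_environment.
Context (R : realType) (eta : probability (environment R) R).
Hypotheses (eta_stationary : stationary eta) (eta_ergodic : ergodic eta).

Definition shiftz (x : int) (omega : environment R) : environment R :=
  fun y => omega (y + x)%R.

Lemma measurable_shiftz x : measurable_fun setT (shiftz x).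
Proof. by apply: measurable_to_prod => y; exact: measurable_proj. Qed.

Lemma measurable_preimage_shiftz x A : measurable A -> measurable (shiftz x @^-1` A).
Proof. by move=> mA; rewrite -[X in measurable X]setTI; exact: measurable_shiftz. Qed.

Lemma shiftzD x y omega : shiftz x (shiftz y omega) = shiftz (x + y)%R omega.
Proof. by apply/funext => z; rewrite /shiftz addrA. Qed.

(** Nonnegative shifts go by induction from the shift by 1; a negative shift is undone by the
    opposite positive one. *)
Lemma shiftz_measure x A : measurable A -> eta (shiftz x @^-1` A) = eta A.
Proof.
have pos (n : nat) B : measurable B -> eta (shiftz n%:Z @^-1` B) = eta B.
  move=> mB; elim: n => [|n IH].
    congr (eta _); apply/seteqP.
    by split=> om /=; rewrite (_ : shiftz 0%R om = om)//; apply/funext => y; rewrite /shiftz addr0.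
  rewrite -[RHS]IH -(eta_stationary (measurable_preimage_shiftz n%:Z mB)).
  congr (eta _); apply/seteqP.
  have sE om : shiftz n.+1%:Z om = shiftz n%:Z (Defs.shift om).
    by apply/funext => y; rewrite /shiftz /Defs.shift -addrA; congr (om _); lia.
  by split=> om /=; rewrite sE.
move=> mA; case: (intP x) => [|n|n]; [exact: pos|exact: pos|].
rewrite -(pos n.+1 _ (measurable_preimage_shiftz _ mA)); congr (eta _).
apply/seteqP; split=> om /=; rewrite shiftzD addNr;
  by rewrite (_ : shiftz 0%R om = om)//; apply/funext => y; rewrite /shiftz addr0.
Qed.

Lemma ge0_integral_shiftz x (g : environment R -> \bar R) :
  measurable_fun setT g -> (forall omega, 0 <= g omega) ->
  \int[eta]_omega g (shiftz x omega) = \int[eta]_omega g omega.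
Proof.
move=> mg g0.
have := ge0_integral_pushforward (measurable_shiftz x) eta measurableT mg
  (fun y _ => g0 y).
rewrite preimage_setT => <-.
apply: eq_measure_integral => [|mphi A mA _]; last exact: shiftz_measure.
exact: measurable_shiftz.
Qed.

(* An event that is increasing along the shift is almost surely invariant. *)
Lemma ergodic_increasing A : measurable A ->
  (forall omega, A omega -> A (Defs.shift omega)) -> 0 < eta A -> eta A = 1.
Proof.
move=> mA Ash A0.
(* The preimages [B k] increase and all have the measure of [A], so their union is an invariant
   event with that same measure. *)
pose B k := iter k (@Defs.shift R) @^-1` A.
have mB k : measurable (B k).
  elim: k => [//|k IH]; rewrite (_ : B k.+1 = shiftz 1%R @^-1` (B k)).
    exact: measurable_preimage_shiftz.
  by apply/seteqP; split=> om; rewrite /B /= -iterSr.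
have etaB k : eta (B k) = eta A.
  elim: k => [//|k IH]; rewrite -IH -(eta_stationary (mB k)); congr (eta _).
  by apply/seteqP; split=> om; rewrite /B /= -iterSr.
have BS k : B k `<=` B k.+1 by move=> om; exact: Ash.
have mU : measurable (\bigcup_k B k) by exact: bigcup_measurable.
have UA : eta (\bigcup_k B k) = eta A.
  have ndB : nondecreasing_seq B.
    by apply/nondecreasing_seqP => k; apply/subsetPset; exact: BS.
  have /cvg_lim <- // := @nondecreasing_cvg_mu _ _ _ eta _ mB mU ndB.
  by rewrite (_ : eta \o B = cst (eta A)) ?lim_cst//; apply/funext => k /=.
have inv : @Defs.shift R @^-1` (\bigcup_k B k) = \bigcup_k B k.
  apply/seteqP; split=> om [k _ Bk].
    by exists k.+1 => //; move: Bk; rewrite /B /= -iterSr.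
  by exists k => //; have := BS _ _ Bk; rewrite /B /= -iterSr.
have [] := eta_ergodic mU inv; rewrite UA// => eA.
by move: A0; rewrite eA ltxx.
Qed.

Lemma window_subS l r N x : (0 < l)%N -> (0 < r)%N ->
  x \in window l r N -> (x + 1)%R \in window l r N.+1.
Proof. by move=> l0 r0; rewrite !mem_window !mulnS; clear -l0 r0; lia. Qed.

(* Half of the ergodic theorem: by Markov's inequality the event has positive
   probability, and it is increasing along the shift since the N-th window moved by 1
   lies in the (N+1)-st one; hence the additive constant C. *)
Lemma ergodic_liminf (l r : nat) (g : environment R -> \bar R) (gamma : R) :
  (0 < l)%N -> (0 < r)%N ->
  measurable_fun setT g -> (forall omega, 0 <= g omega) ->
  \int[eta]_omega g omega < gamma%:E ->
  {ae eta, forall omega : environment R, exists2 C : R, (0 <= C)%R &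
    forall N0, exists2 N, (N0 <= N)%N &
      \sum_(x <- window l r N) g (shiftz x omega) <=
        (gamma * ((l + r) * N)%:R + C)%:E}.
Proof.
move=> l0 r0 mg g0 Eg.
pose S N omega := \sum_(x <- window l r N) g (shiftz x omega).
have mS N : measurable_fun setT (S N).
  apply: emeasurable_sum => x; apply: (measurableT_comp mg).
  exact: measurable_shiftz.
have S0 N omega : 0 <= S N omega by exact: sume_ge0.
have gamma0 : (0 < gamma)%R.
  by rewrite -lte_fin (le_lt_trans _ Eg)// integral_ge0.
pose B (c N : nat) := [set omega | S N omega <= (gamma * ((l + r) * N + c)%:R)%:E].
have mB c N : measurable (B c N).
  by rewrite -[B c N]setTI; exact: emeasurable_fun_infty_c.
pose A := \bigcup_c lim_sup_set (B c).
have mL c : measurable (lim_sup_set (B c)).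
  by apply: bigcap_measurable => // k _; exact: bigcup_measurable.
have mA : measurable A by exact: bigcup_measurable.
have SleS N omega : (0 < N)%N -> S N.-1 (Defs.shift omega) <= S N omega.
  move=> N0; rewrite /S.
  have -> : \sum_(x <- window l r N.-1) g (shiftz x (Defs.shift omega)) =
      \sum_(x <- [seq (x + 1)%R | x <- window l r N.-1]) g (shiftz x omega).
    by rewrite [RHS]big_map; apply: eq_bigr => x _; rewrite -shiftzD.
  set s := map _ _.
  have us : uniq s by rewrite map_inj_uniq ?window_uniq//; exact: addIr.
  have -> : \sum_(x <- s) g (shiftz x omega) =
      \sum_(x <- window l r N | x \in s) g (shiftz x omega).
    rewrite -[RHS]big_filter; apply: perm_big; apply: uniq_perm => //.
      by rewrite filter_uniq ?window_uniq.
    move=> y; rewrite mem_filter andb_idr// => /mapP[x xN ->].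
    by rewrite -(prednK N0) window_subS.
  by rewrite [leRHS](bigID (mem s))/= leeDl// sume_ge0.
have A_shift omega : A omega -> A (Defs.shift omega).
  (* Passing from [N] to [N.-1] lowers the bound by [gamma * (l + r)], which the larger constant
     restores. *)
  move=> [c _ Bc]; exists (c + (l + r))%N => // n _.
  have [N /= nN BN] := Bc n.+1 I.
  exists N.-1 => /=; first by lia.
  have N0 : (0 < N)%N by lia.
  rewrite /B /= (_ : _ + _ = (l + r) * N + c)%N; last first.
    by rewrite -{2}(prednK N0) mulnSr addnA addnAC.
  exact: (le_trans (SleS N omega N0) BN).
have EA : 0 < eta A.
  have Egfin : \int[eta]_omega g omega \is a fin_num.
    by rewrite ge0_fin_numE ?integral_ge0// (lt_trans Eg)// ltry.
  set e := fine (\int[eta]_omega g omega).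
  have eE : \int[eta]_omega g omega = e%:E by rewrite fineK.
  have e0 : (0 <= e)%R by rewrite fine_ge0// integral_ge0.
  have eg : (e < gamma)%R by rewrite -lte_fin -eE.
  have ES N : \int[eta]_omega S N omega = (e * ((l + r) * N).+1%:R)%:E.
    rewrite ge0_integral_sum//; last first.
      by move=> x; apply: (measurableT_comp mg); exact: measurable_shiftz.
    under eq_bigr do rewrite ge0_integral_shiftz// eE.
    rewrite sumEFin big_const_seq count_predT size_map size_iota iter_addr addr0.
    by rewrite mulr_natr.
  (* With constant 1 the threshold is [gamma] times the number of sites of the window, so Markov's
     bound is [e / gamma] for every [N]. *)
  have pB N : (1 - e / gamma)%:E <= eta (B 1%N N).
    pose t := (gamma * ((l + r) * N + 1)%:R)%R.
    have t0 : (0 < t)%R by rewrite mulr_gt0// ltr0n addn1.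
    have Markov : t%:E * eta (~` B 1%N N) <= (e * ((l + r) * N).+1%:R)%:E.
      rewrite -ES -integral_cst; last exact: measurableC.
      apply: (@le_trans _ _ (\int[eta]_(omega in ~` B 1%N N) S N omega)).
        apply: ge0_le_integral => //.
        - exact: measurableC.
        - by move=> omega _; rewrite lee_fin ltW.
        - exact: measurable_funTS.
        - by move=> omega /negP; rewrite -ltNge => /ltW.
      by apply: ge0_subset_integral => //; exact: measurableC.
    have fB : eta (B 1%N N) \is a fin_num by exact: fin_num_measure.
    move: Markov; rewrite probability_setC// -(fineK fB) -EFinB -EFinM !lee_fin.
    rewrite /t addn1 mulrAC ler_pM2r ?ltr0n// => Markov.
    rewrite lerBlDr -lerBlDl ler_pdivlMr// mulrC.
    by move: Markov; rewrite !mulrBr; lra.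
  have : (1 - e / gamma)%:E <= eta (lim_sup_set (B 1%N)).
    have fU : eta (\bigcup_(k >= 0) B 1%N k) < +oo.
      by rewrite (le_lt_trans (probability_le1 _ _)) ?ltry//; exact: bigcup_measurable.
    apply: (cvge_to_ge (lim_sup_set_cvg eta (B 1%N) (mB 1%N) fU)).
    apply: nearW => n; apply: le_trans (pB n) _; apply: le_measure; rewrite ?inE//.
      exact: bigcup_measurable.
    by move=> omega Bn; exists n => /=.
  move=> pL; have : (1 - e / gamma)%:E <= eta A.
    by apply: le_trans pL _; apply: le_measure; rewrite ?inE// => omega ?; exists 1%N.
  by apply: lt_le_trans; rewrite lte_fin subr_gt0 ltr_pdivrMr// mul1r.
have : eta (~` A) = 0.
  by rewrite probability_setC// (ergodic_increasing mA A_shift EA) subee.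
move=> A0; exists (~` A); split => //; first exact: measurableC.
move=> omega; apply: contra_not => -[c _ Bc].
exists (gamma * c%:R)%R; first by rewrite mulr_ge0// ltW.
move=> N0; have [N N0N BN] := Bc N0 I.
by exists N => //; rewrite -mulrDr -natrD.
Qed.
End ergodic_environment.

Section integral_negligible.
Context d (T : measurableType d) (R : realType) (m : {measure set T -> \bar R}).
Import HBNNSimple.

(* Needed for averaged_law and total_drift, whose integrands are not known to be
   measurable. *)
Lemma eq_integral_ae (f g : T -> \bar R) : {ae m, forall x, f x = g x} ->
  \int[m]_x f x = \int[m]_x g x.
Proof.
move=> [N [mN N0 fgN]].
have le_nn f1 f2 : (forall x, 0 <= f1 x) -> (forall x, 0 <= f2 x) ->
    (forall x, ~ N x -> f1 x = f2 x) -> \int[m]_x f1 x <= \int[m]_x f2 x.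
  move=> f10 f20 f12; rewrite !ge0_integralTE//.
  apply: ge_ereal_sup => _ [h /= hf1 <-].
  (* Set to 0 on [N], a simple minorant of [f1] becomes one of [f2] with the same integral. *)
  pose h' := proj_nnsfun h (measurableC mN).
  apply: (@le_trans _ _ (sintegral m h')); last first.
    apply: ereal_sup_ubound; exists h' => //= x; rewrite mindicE.
    case: (boolP (x \in ~` N)) => [|_]; last by rewrite mulr0.
    by rewrite inE => Nx; rewrite mulr1 -f12.
  rewrite -!integralT_nnsfun le_eqVlt; apply/orP; left; apply/eqP.
  apply: ae_eq_integral => //; [exact/measurable_EFinP..|].
  exists N; split=> // x /= /not_implyP[_ hx]; apply: contrapT => Nx; apply: hx.
  by rewrite mindicE mem_set ?mulr1.
have fg x : ~ N x -> f x = g x by move=> Nx; apply: contrapT => fgx; apply: Nx; exact: fgN.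
rewrite integralE [RHS]integralE; congr (_ - _); apply/eqP; rewrite eq_le !le_nn//.
all: by move=> x Nx; rewrite ?funeposE ?funenegE fg.
Qed.

End integral_negligible.

(** * Measurability of recurrence and transience *)

Section path_limit_events.
Context (R : realType).

Lemma measurable_io x : measurable [set X : path_space | io X x].
Proof.
rewrite (_ : [set X | _] = lim_sup_set (fun k => [set X : path_space | X k = x])).
  apply: bigcap_measurable => // n _; apply: bigcup_measurable => k _.
  by apply: (@past_measurable k); exact: past_coord.
apply/seteqP; split=> [X Xx n _|X Xx n]; last first.
  by have [k nk Xk] := Xx n I; exists k.
by have [k [nk Xk]] := Xx n; exists k.
Qed.

Lemma measurable_recurrent : measurable (recurrent R).
Proof.
rewrite (_ : recurrent R = \bigcap_n
   (if @unpickle int n is Some x then [set X : path_space | io X x] else setT)).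
  by apply: bigcap_measurable => // n _; case: unpickle => // x; exact: measurable_io.
apply/seteqP; split=> [X /recurrent_io Xio n _|X Xio].
  by case: unpickle => // x; exact: Xio.
by apply/recurrent_io => x; have := Xio (pickle x) I; rewrite pickleK.
Qed.

Lemma measurable_transient_right : measurable (transient_right R).
Proof.
rewrite (_ : transient_right R = \bigcap_L \bigcup_n
    [set X : path_space | forall k, (n <= k)%N -> (L%:Z <= X k)%R]).
  apply: bigcap_measurable => // L _; apply: bigcup_measurable => n _.
  exact: (measurable_always n (fun y => (L%:Z <= y)%R)).
apply/seteqP; split=> X.
  move=> /cvgryPge Xoo L _; have [n _ nP] := Xoo L%:R%R; exists n => // k nk.
  by have := nP k nk; rewrite /= -[L%:R%R]/(L%:Z%:~R : R)%R ler_int.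
move=> Xoo; apply/cvgryPge => A; have [n _ nP] := Xoo (Num.truncn A).+1 I.
exists n => // k /= nk; apply: le_trans (_ : (Num.truncn A).+1%:R <= _)%R.
  exact/ltW/truncnS_gt.
by rewrite -[_%:R]/(_%:Z%:~R) ler_int nP.
Qed.

Lemma probability_ae1 d (T : measurableType d) (m : probability T R) (A : set T) :
  measurable A -> {ae m, forall x, A x} -> m A = 1.
Proof.
move=> mA [N [mN N0 AN]]; have A0 : m (~` A) = 0.
  by apply: subset_measure0 N0 => //; exact: measurableC.
by rewrite -(setCK A) probability_setC ?A0 ?sube0//; exact: measurableC.
Qed.

End path_limit_events.

(** Equality of bundled measures, as in [omega x j = mu], reduces to equality of set functions by
    proof irrelevance. *)
Lemma eq_probability (R : realType) d (T : measurableType d) (m1 m2 : probability T R) :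
  m1 = m2 :> (set T -> \bar R) -> m1 = m2.
Proof.
case: m1 m2 => [f1 [[a1 b1] [c1] [d1] [e1] [g1] [h1] [i1]]].
case=> [f2 [[a2 b2] [c2] [d2] [e2] [g2] [h2] [i2]]] /= f12.
move: a2 b2 c2 d2 e2 g2 h2 i2; rewrite -f12 => a2 b2 c2 d2 e2 g2 h2 i2.
have := (Prop_irrelevance a1 a2, Prop_irrelevance b1 b2, Prop_irrelevance c1 c2,
  Prop_irrelevance d1 d2).
have := (Prop_irrelevance e1 e2, Prop_irrelevance g1 g2, Prop_irrelevance h1 h2,
  Prop_irrelevance i1 i2).
by move=> [[[-> ->] ->] ->] [[[-> ->] ->] ->].
Qed.

(** * Measurable functionals of the cookies *)

Section random_cookies.
Context (R : realType).

Lemma measurable_eval (U : set int) :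
  measurable_fun setT (fun nu : M1 R => (nu : probability int R) U).
Proof. exact: (measurable_kernel (kprobability (@measurable_id _ (M1 R) setT)) U). Qed.

Lemma measurable_ge0_integral (h : int -> \bar R) : (forall z, 0 <= h z) ->
  measurable_fun setT (fun nu : M1 R => \int[nu : probability int R]_z h z).
Proof.
move=> h0; apply: (measurable_fun_integral_kernel
  (l := fun nu : M1 R => (nu : probability int R))) => // U _.
exact: measurable_eval.
Qed.

Lemma measurable_mean : measurable_fun setT (fun nu : M1 R => mean (nu : probability int R)).
Proof.
rewrite /mean unlock.
pose f (z : int) : \bar R := (z%:~R)%:E.
rewrite (_ : (fun nu => _) = (fun nu : M1 R =>
  \int[nu : probability int R]_z f^\+ z - \int[nu : probability int R]_z f^\- z)); last first.
  by apply/funext => nu; rewrite integralE.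
by apply: emeasurable_funB; apply: measurable_ge0_integral.
Qed.

Lemma measurable_cookie x j :
  measurable_fun setT (fun omega : environment R => omega x j : M1 R).
Proof.
exact: (measurableT_comp (@measurable_proj nat _ (M1 R) j)
  (@measurable_proj int _ (cookie_stack R) x)).
Qed.

Lemma has_meanE (nu : probability int R) :
  has_mean nu <-> \int[nu]_z (`|z|%:~R)%:E < +oo.
Proof.
have E : \int[nu]_z (`|z|%:~R)%:E = \int[nu]_z `|(z%:~R : R)%:E|.
  by apply: eq_integral => z _; rewrite abse_EFin intr_norm.
by rewrite E /has_mean; split=> [/integrableP[]//|hz]; apply/integrableP.
Qed.

(** The conditions are countably many, and [[set mu]] is measurable because countably many point
    masses determine a law on the integers. *)
Lemma measurable_Omega_plus (M : nat) (mu : probability int R) :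
  measurable (Omega_plus M mu).
Proof.
have mMp : measurable (@M_plus R).
  rewrite (_ : @M_plus R =
    [set nu : M1 R | \int[nu : probability int R]_z (`|z|%:~R)%:E < +oo] `&`
    [set nu : M1 R | 0 <= mean (nu : probability int R)]).
    apply: measurableI.
      rewrite -[X in measurable X]setTI; apply: emeasurable_fun_infty_o => //.
      by apply: measurable_ge0_integral => z; rewrite lee_fin ler0z.
    rewrite -[X in measurable X]setTI; apply: emeasurable_fun_c_infty => //.
    exact: measurable_mean.
  by apply/seteqP; split=> nu [/has_meanE].
have mmu : measurable [set mu : M1 R].
  rewrite (_ : [set mu] = \bigcap_n (if @unpickle int n is Some z then
      [set nu : M1 R | (nu : probability int R) [set z] = mu [set z]] else setT)).
    apply: bigcap_measurable => // n _; case: unpickle => // z.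
    have := measurable_eval [set z] measurableT (emeasurable_set1 (mu [set z])).
    by rewrite setTI.
  apply/seteqP; split=> [_ -> n _|nu nuP]; first by case: unpickle.
  have nuz z : (nu : probability int R) [set z] = mu [set z].
    by have := nuP (pickle z) I; rewrite pickleK.
  apply: eq_probability; apply/funext => U.
  have := @ge0_integral_transfer _ _ int int R int nu mu id id setT setT 1%R
    (fun z => (\1_U z)%:E).
  rewrite !integral_indic// !setIT mul1e; apply=> // z.
  by rewrite !setTI mul1e; exact: nuz.
rewrite (_ : Omega_plus M mu = \bigcap_n
  (if @unpickle (int * nat)%type n is Some (x, j) then
    if (j < M)%N then (fun omega : environment R => omega x j) @^-1` (@M_plus R)
    else (fun omega : environment R => omega x j) @^-1` [set mu : M1 R]
   else setT)).
  apply: bigcap_measurable => // n _; case: unpickle => // -[x j].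
  by case: ifP => _; rewrite -[X in measurable X]setTI; exact: measurable_cookie.
apply/seteqP; split=> [omega om n _|omega om x].
  case: unpickle => // -[x j]; case: ifPn => jM; first exact: (om x).1.
  by rewrite -leqNgt in jM; exact: (om x).2.
split=> j jM; first by have := om (pickle (x, j)) I; rewrite pickleK jM.
by have := om (pickle (x, j)) I; rewrite pickleK ltnNge jM.
Qed.

End random_cookies.

(** * Tail sums of a jump distribution *)

Section tails.
Context (R : realType).
Implicit Types nu : probability int R.

Definition far (n : nat) : set int := [set z | (n <= `|z|)%N].

Definition mean_abs nu : \bar R := \int[nu]_z (`|z|%:~R)%:E.

Lemma mean_abs_ge0 nu : 0 <= mean_abs nu.
Proof. by apply: integral_ge0 => z _; rewrite lee_fin ler0z. Qed.

(** Tail formula for the mean: exactly [|z| + 1] indices [n], counting 0, satisfy [n <= |z|]. *)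
Lemma sum_far_le nu N : \sum_(n < N) nu (far n) <= 1 + mean_abs nu.
Proof.
rewrite -(@probability_setT _ _ _ nu) -[X in X + _]mul1e -integral_cst//.
rewrite -ge0_integralD//.
rewrite (eq_bigr (fun n : 'I_N => \int[nu]_z (\1_(far n) z)%:E)); last first.
  by move=> n _; rewrite integral_indic// setIT.
rewrite -ge0_integral_sum//.
apply: ge0_le_integral => //.
  by move=> z _; apply: sume_ge0 => n _; rewrite lee_fin.
move=> z _; rewrite sumEFin -EFinD lee_fin.
under eq_bigr do rewrite indicE.
rewrite -natr_sum -abszE -[(_%:~R)%R]/(`|z|%N%:R)%R -(natrD _ 1) ler_nat add1n.
rewrite (eq_bigr (fun i : 'I_N => (i <= `|z|)%N : nat)); last first.
  by move=> i _; congr nat_of_bool; apply/idP/idP; rewrite inE.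
rewrite (_ : \sum_(i < N) _ = minn N `|z|.+1)%N ?geq_minr//.
elim: {+}N => [|n IH]; first by rewrite big_ord0 min0n.
by rewrite big_ord_recr/= IH; clear; case: leqP; lia.
Qed.

(** The same formula started at [K + 1]: the overshoot of [|z|] over [K] counts the levels above [K]
    that [|z|] reaches. *)
Lemma excess_le_far K nu : excess K nu <= \sum_(n <oo) nu (far (K.+1 + n)).
Proof.
rewrite (eq_eseriesr (g := fun n => \int[nu]_z (\1_(far (K.+1 + n)) z)%:E)); last first.
  by move=> n _; rewrite integral_indic// setIT.
rewrite -integral_nneseries//.
apply: ge0_le_integral => //.
move=> z _.
apply: (@le_trans _ _ (\sum_(0 <= n < `|z| - K) (\1_(far (K.+1 + n)) z)%:E)); last first.
  by apply: nneseries_lim_ge => n _ _; rewrite lee_fin.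
rewrite big_nat (eq_bigr (cst 1%:E)) => [|n nK]; last first.
  by rewrite indicE mem_set//= /far/=; move: nK; clear; lia.
rewrite -big_nat sumEFin lee_fin sumr_const_nat subn0 ge_max ler0n/=.
rewrite lerBlDr -natrD -abszE -[(_%:~R)%R]/(`|z|%N%:R)%R ler_nat.
by clear; lia.
Qed.
End tails.

(** * Consequences of the first-moment condition on the cookies *)

Section random_environment.
Context (R : realType) (M : nat) (eta : probability (environment R) R).
Hypotheses (eta_stationary : stationary eta) (eta_ergodic : ergodic eta)
  (abs_drift_fin : abs_drift M eta < +oo).

Let fars n (omega : environment R) : \bar R :=
  \sum_(j < M) (omega 0%R j : probability int R) (far n).

Let mfars n : measurable_fun setT (fars n).
Proof.
apply: emeasurable_sum => j.
exact: (measurableT_comp (measurable_eval (far n)) (measurable_cookie 0%R j)).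
Qed.

Let fars_ge0 n omega : 0 <= fars n omega.
Proof. by apply: sume_ge0. Qed.

(** Summed over the [M] cookies at 0, [sum_far_le] gives [M] plus the integrand of [abs_drift]. *)
Lemma sum_fars_lty : \sum_(n <oo) \int[eta]_omega fars n omega < +oo.
Proof.
pose h (omega : environment R) : \bar R :=
  \sum_(j < M) mean_abs (omega 0%R j : probability int R).
have mh : measurable_fun setT h.
  apply: emeasurable_sum => j.
  apply: (measurableT_comp _ (measurable_cookie 0%R j)).
  by apply: measurable_ge0_integral => z; rewrite lee_fin ler0z.
have h0 omega : 0 <= h omega by apply: sume_ge0 => j _; exact: mean_abs_ge0.
have Eh : \int[eta]_omega h omega < +oo.
  move: abs_drift_fin; rewrite /abs_drift.
  by under eq_integral do under eq_bigr do rewrite unlock.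
apply: (@le_lt_trans _ _ (\int[eta]_omega (M%:R%:E + h omega))); last first.
  rewrite ge0_integralD//.
  rewrite integral_cst// lte_add_pinfty//.
  by rewrite [X in _ * X]probability_setT mule1 ltry.
apply: nneseries_le_ub => [n|N]; first exact: integral_ge0.
rewrite -ge0_integral_sum//; apply: ge0_le_integral => //.
- by move=> omega _; exact: sume_ge0.
- exact: emeasurable_sum.
- exact: emeasurable_funD.
move=> omega _; rewrite /fars exchange_big/=.
apply: (@le_trans _ _ (\sum_(j < M) (1 + mean_abs (omega 0%R j : probability int R)))).
  by apply: lee_sum => j _; exact: sum_far_le.
rewrite big_split/= leeD2r// sumEFin lee_fin sumr_const card_ord.
exact: lexx.
Qed.

Let fars_shift x n omega : fars n (shiftz x omega) =
  \sum_(j < M) (omega x j : probability int R) (far n).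
Proof. by rewrite /fars /shiftz; under eq_bigr do rewrite add0r. Qed.

(** By stationarity site [x] contributes on average as much as [fars |x|] at 0. Pairing [n] with
    [-n], the mean of the total is at most twice the sum in [sum_fars_lty], so the total is almost
    surely finite. *)
Lemma ae_far_jumps : {ae eta, forall omega : environment R, exists C : R,
  forall V, \sum_(i < V.*2) \sum_(j < M)
     (omega (i%:Z - V%:Z)%R j : probability int R) (far `|(i%:Z - V%:Z)%R|) <= C%:E}.
Proof.
pose f (x : int) omega := fars `|x|%N (shiftz x omega).
have mf x : measurable_fun setT (f x).
  exact: (measurableT_comp (mfars _) (measurable_shiftz x)).
have f0 x omega : 0 <= f x omega by exact: fars_ge0.
have Ef x : \int[eta]_omega f x omega = \int[eta]_omega fars `|x|%N omega.
  exact: (ge0_integral_shiftz eta_stationary).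
pose S omega := \sum_(n <oo) (f n%:Z omega + f (- n%:Z)%R omega).
have S0 omega : 0 <= S omega by apply: nneseries_ge0 => n _ _; exact: adde_ge0.
have mS : measurable_fun setT S.
  apply: ge0_emeasurable_sum => [n omega _ _|n _]; first exact: adde_ge0.
  exact: emeasurable_funD.
have ES : \int[eta]_omega S omega < +oo.
  rewrite integral_nneseries//; last 2 first.
  - by move=> n; exact: emeasurable_funD.
  - by move=> n omega _; exact: adde_ge0.
  under eq_eseriesr do rewrite ge0_integralD// !Ef absz_nat abszN absz_nat.
  rewrite nneseriesD//; last 2 first.
  - by move=> n _ _; exact: integral_ge0.
  - by move=> n _ _; exact: integral_ge0.
  by rewrite lte_add_pinfty// sum_fars_lty.
have : eta.-integrable setT S.
  apply/integrableP; split=> //.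
  by under eq_integral do rewrite gee0_abs//.
move=> /(integrable_ae measurableT); apply: filterS => omega /(_ I) Sfin.
exists (fine (S omega)) => V; rewrite fineK//.
rewrite (eq_bigr (fun i : 'I_V.*2 => f (i%:Z - V%:Z)%R omega)); last first.
  by move=> i _; rewrite /f fars_shift.
(* The window [[-V, V)] lacks the site [V]; adding its term lets the induction proceed by one site
   on each side. *)
have main : \sum_(i < V.*2) f (i%:Z - V%:Z)%R omega + f V%:Z omega <=
    \sum_(n < V.+1) (f n%:Z omega + f (- n%:Z)%R omega).
  elim: V => [|V IH].
    by rewrite big_ord0 add0e big_ord_recl big_ord0 adde0 leeDl.
  rewrite doubleS big_ord_recl big_ord_recr/= [leRHS]big_ord_recr/=.
  rewrite (_ : (V.*2.+1%:Z - V.+1%:Z = V%:Z)%R); last by lia.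
  rewrite sub0r (eq_bigr (fun i : 'I_V.*2 => f (i%:Z - V%:Z)%R omega)); last first.
    by move=> i _; rewrite /bump/=; congr (f _ omega); lia.
  by rewrite [X in X + _]addeC -addeA [X in _ + X]addeC; exact: leeD2r.
apply: le_trans (_ : _ <= _) _; last first.
  apply: (@nneseries_lim_ge _ (fun n => f n%:Z omega + f (- n%:Z)%R omega) xpredT 0 V.+1).
  by move=> n _ _; exact: adde_ge0.
by rewrite big_mkord; apply: le_trans main; rewrite leeDl.
Qed.

(** The mean excess is bounded by a tail of the convergent series of [sum_fars_lty]. *)
Lemma excess_mean_small (Bd : nat) (e : R) : (0 < e)%R -> exists2 K, (Bd <= K)%N &
  \int[eta]_omega \sum_(j < M) excess K (omega 0%R j : probability int R) < e%:E.
Proof.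
move=> e0.
have cv := @nneseries_tail_cvg R (fun n => \int[eta]_omega fars n omega) xpredT
  sum_fars_lty (fun n _ => integral_ge0 _ (fun omega _ => fars_ge0 n omega)).
have /cv[N _ NP] : nbhs (0 : \bar R) [set x | x < e%:E].
  by apply: open_nbhs_nbhs; split; [exact: open_ereal_lt_ereal|rewrite /= lte_fin].
exists (maxn Bd N); first exact: leq_maxl.
apply: le_lt_trans (NP (maxn Bd N).+1 _); last by rewrite /= leqW// leq_maxr.
set K := maxn Bd N.
apply: (@le_trans _ _ (\int[eta]_omega \sum_(n <oo) fars (K.+1 + n) omega)).
  apply: ge0_le_integral => //.
  - by move=> omega _; apply: sume_ge0 => j _; exact: excess_ge0.
  - apply: emeasurable_sum => j.
    apply: (measurableT_comp _ (measurable_cookie 0%R j)).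
    by apply: measurable_ge0_integral => z; rewrite lee_fin le_max lexx.
  - apply: ge0_emeasurable_sum => // n omega _ _; exact: fars_ge0.
  move=> omega _; rewrite /fars nneseries_sum//.
  by apply: lee_sum => j _; exact: excess_le_far.
rewrite integral_nneseries//.
rewrite -nneseries_addn => [|n]; last by apply: integral_ge0 => omega _; exact: fars_ge0.
by rewrite le_eqVlt; apply/orP; left; apply/eqP; apply: eq_eseriesr => n _; rewrite addnC.
Qed.
End random_environment.

(** * The averaged law *)

Section quenched_to_averaged.
Context (R : realType) (M : nat) (mu : probability int R)
  (eta : probability (environment R) R)
  (P : environment R -> probability path_space R).
Hypotheses (P_law : forall omega, excited_walk_law omega 0%R (P omega))
  (mu_M_zero : M_zero mu) (eta_stationary : stationary eta) (eta_ergodic : ergodic eta)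
  (eta_Omega_plus : eta (Omega_plus M mu) = 1)
  (mu_bounded : exists B : R, mu [set z : int | `|z%:~R| <= B]%R = 1)
  (mu_span : span_one mu)
  (abs_drift_fin : abs_drift M eta < +oo).

Let ae_Omega_plus : {ae eta, forall omega, Omega_plus M mu omega}.
Proof.
exists (~` Omega_plus M mu); split=> //.
  by apply: measurableC; exact: measurable_Omega_plus.
rewrite probability_setC ?eta_Omega_plus ?subee//; exact: measurable_Omega_plus.
Qed.

Let mu_bounded_nat : exists Bd : nat, mu [set z | (`|z| <= Bd)%N] = 1.
Proof.
have [B muB] := mu_bounded; exists (Num.truncn B).+1.
apply/eqP; rewrite eq_le probability_le1//= -muB.
apply: le_measure; rewrite ?inE// => z /= zB.
rewrite -(ler_nat R) natr_absz intr_norm (le_trans zB)//.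
exact/ltW/truncnS_gt.
Qed.

Lemma Omega_plus_mean omega : Omega_plus M mu omega -> forall x j,
  has_mean (omega x j : probability int R) /\ 0 <= mean (omega x j : probability int R).
Proof.
move=> om x j; have [jM|Mj] := ltnP j M; first exact: (om x).1.
by rewrite (om x).2//; have [hm ->] := mu_M_zero.
Qed.

Lemma averaged_eq1 (A : set path_space) : measurable A ->
  {ae eta, forall omega, {ae P omega, forall X, A X}} -> averaged_law eta P A = 1.
Proof.
move=> mA aeA; rewrite /averaged_law (@eq_integral_ae _ _ _ eta _ (cst 1)).
  by rewrite integral_cst// mul1e [LHS]probability_setT.
by move: aeA; apply: filterS => omega; exact: probability_ae1.
Qed.

Lemma ae_recurrent_or_transient :
  {ae eta, forall omega, {ae P omega, forall X, (recurrent R `|` transient_right R) X}}.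
Proof.
have [Bd muBd] := mu_bounded_nat.
have [mu_mean mu_mean0] := mu_M_zero.
have e8 : (0 < 1 / 8 :> R)%R by lra.
have [K BK EK] := excess_mean_small abs_drift_fin Bd e8.
pose g (omega : environment R) := \sum_(j < M) excess K (omega 0%R j : probability int R).
have mg : measurable_fun setT g.
  apply: emeasurable_sum => j.
  apply: (measurableT_comp _ (measurable_cookie 0%R j)).
  by apply: measurable_ge0_integral => z; rewrite lee_fin le_max lexx.
have g0 omega : 0 <= g omega by apply: sume_ge0 => j _; exact: excess_ge0.
have freq := ergodic_liminf eta_stationary eta_ergodic (ltn0Sn 0) (ltn0Sn 0) mg g0 EK.
have far := ae_far_jumps eta_stationary abs_drift_fin.
apply: filterS (filterI ae_Omega_plus (filterI freq far)).
move=> omega [om [[C1 C10 C1P] [C2 C2P]]].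
have omean := Omega_plus_mean om.
apply: (omega_recurrent_or_transient (proj2 (P_law omega)) (fun x => (om x).2)
  mu_mean mu_mean0 mu_span muBd (fun x j => (omean x j).1) (fun x j => (omean x j).2)
  BK C10 _ C2P).
move=> N0; have [N N0N NP] := C1P N0; exists N => //.
apply: le_trans NP; rewrite le_eqVlt; apply/orP; left; apply/eqP.
by apply: eq_bigr => x _; rewrite /g /shiftz; under [RHS]eq_bigr do rewrite add0r.
Qed.

Lemma ae_not_transient : total_drift eta < 1 ->
  {ae eta, forall omega, {ae P omega, forall X, ~ transient_right R X}}.
Proof.
move=> delta1.
have [Bd muBd] := mu_bounded_nat.
have [mu_mean mu_mean0] := mu_M_zero.
(* The absolute values make [d] nonnegative everywhere, as [ergodic_liminf] requires; almost surely
   they change nothing. *)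
pose d (omega : environment R) := \sum_(j < M) `|mean (omega 0%R j : probability int R)|.
have md : measurable_fun setT d.
  apply: emeasurable_sum => j; apply: measurableT_comp => //.
  exact: (measurableT_comp (@measurable_mean R) (measurable_cookie 0%R j)).
have d0 omega : 0 <= d omega by apply: sume_ge0.
have dE : total_drift eta = \int[eta]_omega d omega.
  apply: eq_integral_ae; move: ae_Omega_plus; apply: filterS => omega om.
  rewrite (nneseries_split 0%N M); last by move=> j _; exact: (Omega_plus_mean om _ _).2.
  rewrite add0n eseries0 ?adde0 ?big_mkord; last first.
    by move=> j Mj _; rewrite (om 0%R).2.
  by apply: eq_bigr => j _; rewrite gee0_abs//; exact: (Omega_plus_mean om _ _).2.
rewrite dE in delta1.
have dfin : \int[eta]_omega d omega \is a fin_num.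
  by rewrite ge0_fin_numE ?integral_ge0// (lt_trans delta1)// ltry.
set e := fine (\int[eta]_omega d omega).
have eE : \int[eta]_omega d omega = e%:E by rewrite fineK.
have e1 : (e < 1)%R by rewrite -lte_fin -eE.
have e0 : (0 <= e)%R by rewrite fine_ge0// integral_ge0.
have e2 : (0 < (1 - e) / 2)%R by rewrite divr_gt0// subr_gt0.
have [K BK EK] := excess_mean_small abs_drift_fin Bd e2.
pose gK (omega : environment R) := \sum_(j < M) excess K (omega 0%R j : probability int R).
have mgK : measurable_fun setT gK.
  apply: emeasurable_sum => j.
  apply: (measurableT_comp _ (measurable_cookie 0%R j)).
  by apply: measurable_ge0_integral => z; rewrite lee_fin le_max lexx.
have gK0 omega : 0 <= gK omega by apply: sume_ge0 => j _; exact: excess_ge0.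
(* The midpoint between [e] and 1: the drift takes [e], and the excess less than the remaining
   [(1 - e) / 2]. *)
pose gamma : R := ((1 + e) / 2)%R.
have gamma0 : (0 <= gamma)%R by rewrite divr_ge0// addr_ge0.
have gamma1 : (gamma < 1)%R by rewrite /gamma; lra.
have Eg : \int[eta]_omega (d omega + gK omega) < gamma%:E.
  rewrite ge0_integralD// eE (_ : gamma = e + (1 - e) / 2)%R; last by rewrite /gamma; field.
  by rewrite EFinD lteD2lE.
(* The window extends so far to the right that [(1 - gamma) * b > 1], which gives the inequality
   needed to exit on the left. *)
pose b := (Num.truncn (1 / (1 - gamma))).+1.
have bP : (1 + gamma * (1 + b)%:R < (1 + b)%:R)%R.
  have : (1 / (1 - gamma) < b%:R)%R by exact: truncnS_gt.
  by rewrite ltr_pdivrMr ?subr_gt0// natrD; lra.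
have freq := ergodic_liminf eta_stationary eta_ergodic (ltn0Sn 0) (ltn0Sn _ : (0 < b)%N)
  (emeasurable_funD md mgK) (fun omega => adde_ge0 (d0 omega) (gK0 omega)) Eg.
apply: filterS (filterI ae_Omega_plus freq) => omega [om [C C0 CP]].
have omean := Omega_plus_mean om.
apply: (omega_not_transient (proj2 (P_law omega)) (fun x => (om x).2)
  mu_mean mu_mean0 mu_span muBd (fun x j => (omean x j).1) (fun x j => (omean x j).2)
  BK (ltn0Sn _ : (0 < b)%N) gamma0 C0 bP).
move=> N0; have [N N0N NP] := CP N0; exists N => //.
apply: le_trans NP; rewrite le_eqVlt; apply/orP; left; apply/eqP.
apply: eq_bigr => x _; rewrite big_split/=; congr (_ + _).
  apply: eq_bigr => j _; rewrite /shiftz add0r gee0_abs//; exact: (omean x j).2.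
by apply: eq_bigr => j _; rewrite /shiftz add0r.
Qed.

End quenched_to_averaged.

Theorem theorem1p4 (R : realType) (M : nat) (mu : probability int R)
    (eta : probability (environment R) R)
    (P : environment R -> probability path_space R)
    (P_law : forall omega, excited_walk_law omega 0%R (P omega))
    (M_ge1 : (1 <= M)%N)
    (mu_M_zero : M_zero mu)
    (mu_not_dirac : mu <> dirac (0%R : int) :> (set int -> \bar R))
    (eta_stationary : stationary eta)
    (eta_ergodic : ergodic eta)
    (eta_Omega_plus : eta (Omega_plus M mu) = 1)
    (mu_bounded : exists B : R, mu [set z : int | `|z%:~R| <= B]%R = 1)
    (mu_span : span_one mu)
    (abs_drift_fin : abs_drift M eta < +oo) :
  averaged_law eta P (recurrent R `|` transient_right R) = 1 /\
  (total_drift eta < 1 -> averaged_law eta P (recurrent R) = 1).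
Proof.
have RT := ae_recurrent_or_transient P_law mu_M_zero eta_stationary eta_ergodic
  eta_Omega_plus mu_bounded mu_span abs_drift_fin.
split=> [|delta1]; apply: averaged_eq1.
- exact: measurableU (measurable_recurrent R) (measurable_transient_right R).
- exact: RT.
- exact: measurable_recurrent.
have nT := ae_not_transient P_law mu_M_zero eta_stationary eta_ergodic
  eta_Omega_plus mu_bounded mu_span abs_drift_fin delta1.
apply: filterS (filterI RT nT) => omega [RTo nTo].
by apply: filterS (filterI RTo nTo) => X [[]].
Qed.
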